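(* Let $A,H$ be nondegenerately dually paired Hopf algebras with bijective antipode, and let $\Lambda^1$ be a finite-dimensional right $A$-crossed module mutually adjoint to $\Lambda^{1*}$, a right $H$-crossed module. If a generalised first order bicovariant differential calculus $(\Lambda^1,\omega)$ on $A$ extends to a strongly bicovariant differential exterior algebra on $\Omega(A)=A\#B_-(\Lambda^1)$, then it does so uniquely, with $\delta$ given in degree $1$ by $$\delta\eta=-\,\cdot[2,-\Psi]^{-1}(\eta_0\otimes\omega(\pi(\eta_1))),\qquad\forall\eta\in\Lambda^1.$$ Here $[2,-\Psi]=\mathrm{id}-\Psi$ is not assumed to be invertible, but the choice of inverse element (preimage under $[2,-\Psi]$) does not change the result in $\Lambda^2$, the degree $2$ part of $B_-(\Lambda^1)$; the symbol $\cdot$ denotes the product of $B_-(\Lambda^1)$.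
   Context: We work over a field $k$ of characteristic not $2$. $A^+=\ker\epsilon$, $\pi(a)=a-\epsilon(a)1$. A right $A$-crossed module is a vector space $V$ with right action $\triangleleft$ and right coaction $\Delta_Rv=v_0\otimes v_1$ of $A$ such that $\Delta_R(v\triangleleft a)=v_0\triangleleft a_{(2)}\otimes(Sa_{(1)})v_1a_{(3)}$; these form a braided category with $\Psi(v\otimes w)=w_0\otimes v\triangleleft w_1$. Mutually adjoint means $\langle\phi\triangleleft h,v\rangle=\langle\phi,v_0\rangle\langle v_1,h\rangle$ and $\langle\phi,v\triangleleft a\rangle=\langle\phi_0,v\rangle\langle a,\phi_1\rangle$ for all $\phi\in\Lambda^{1*},v\in\Lambda^1,h\in H,a\in A$. A generalised first order bicovariant calculus $(\Lambda^1,\omega)$ is given by a crossed module map $\omega:A^+\to\Lambda^1$, where $A^+$ has $a\triangleleft b=ab$ and $\Delta_R(a)=a_{(2)}\otimes(Sa_{(1)})a_{(3)}$; it is $\Omega^1=A\otimes\Lambda^1$, $\mathrm{d}a=a_{(1)}\otimes\omega(\pi(a_{(2)}))$. With $\Psi_i$ denoting $\Psi$ in tensor factors $i,i+1$, let $[n,\Psi]=\mathrm{id}+\Psi_1+\Psi_1\Psi_2+\cdots+\Psi_1\cdots\Psi_{n-1}$ and $[n,\Psi]!=(\mathrm{id}\otimes[n-1,\Psi]!)[n,\Psi]$. $B_-(\Lambda^1)=T_-\Lambda^1/\oplus_n\ker[n,-\Psi]!$, where $T_-\Lambda^1$ is the tensor algebra as a braided-super Hopf algebra with $\Lambda^1$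 odd and primitive. $A\#\Lambda$ is the super-Hopf algebra $A\otimes\Lambda$ with $(a\otimes\eta)(b\otimes\zeta)=ab_{(1)}\otimes(\eta\triangleleft b_{(2)})\zeta$ and $\Delta(a\otimes\eta)=a_{(1)}\otimes(\eta^1)_0\otimes a_{(2)}(\eta^1)_1\otimes\eta^2$. A strongly bicovariant differential exterior algebra on $A\#\Lambda$ is a degree $1$ map $\mathrm{d}$ with $\mathrm{d}^2=0$ that is a super-derivation and a super-coderivation, $\Delta\mathrm{d}=(\mathrm{d}\otimes\mathrm{id}+(-1)^{|\ |}\otimes\mathrm{d})\Delta$. It extends the first order calculus if it agrees with it on $A$; it then has the form $\mathrm{d}(a\otimes\eta)=a_{(1)}\otimes\omega(\pi(a_{(2)}))\eta+a\otimes\delta\eta$ for a degree $1$ super-derivation $\delta:\Lambda\to\Lambda$, the restriction of $\mathrm{d}$ to left-invariant forms. *)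

(* Defs.v *)
From HB Require Import structures.
From mathcomp Require Import all_boot all_order all_algebra.
From mathcomp Require Import boolp.

Set Implicit Arguments.
Unset Strict Implicit.
Unset Printing Implicit Defensive.

Import GRing.Theory.
Local Open Scope ring_scope.
Local Open Scope quotient_scope.

(** [pres good] is the vector space on generators [pgen x], [x : X], subject to
    the relations satisfied by all maps [f : X -> U] into a vector space for
    which [good U f] holds: it is the free vector space [seq (k * X)] of formal
    sums modulo the sums on which every good map vanishes.  When the goodness
    condition is a set of linear equations between the values of [f], this is
    the quotient of the free vector space by the subspace they span.  It is used
    for tensor products, tensor algebras and quotient spaces. *)
Section Presentation.
Variables (k : fieldType) (X : choiceType).
Variable good : forall U : lmodType k, (X -> U) -> Prop.

Definition fsum (U : lmodType k) (f : X -> U) (s : seq (k * X)) : U :=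
  \sum_(p <- s) p.1 *: f p.2.

Definition fscale (c : k) (s : seq (k * X)) : seq (k * X) :=
  [seq (c * p.1, p.2) | p <- s].

Lemma fsum_cat (U : lmodType k) (f : X -> U) s t : fsum f (s ++ t) = fsum f s + fsum f t.
Proof. by rewrite /fsum big_cat. Qed.

Lemma fsum_scale (U : lmodType k) (f : X -> U) c s : fsum f (fscale c s) = c *: fsum f s.
Proof.
rewrite /fsum /fscale big_map scaler_sumr.
by apply: eq_bigr => p _; rewrite scalerA.
Qed.

Definition pres_eq (s t : seq (k * X)) : bool :=
  `[< forall (U : lmodType k) (f : X -> U), good f -> fsum f s = fsum f t >].

Lemma pres_eq_refl : reflexive pres_eq.
Proof. by move=> s; apply/asboolP. Qed.

Lemma pres_eq_sym : symmetric pres_eq.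
Proof. by move=> s t; apply/asboolP/asboolP => e U f fg; rewrite e. Qed.

Lemma pres_eq_trans : transitive pres_eq.
Proof.
move=> t s r /asboolP e1 /asboolP e2; apply/asboolP => U f fg.
by rewrite e1 ?e2.
Qed.

Canonical pres_equiv := EquivRel pres_eq pres_eq_refl pres_eq_sym pres_eq_trans.

Definition pres_sort := {eq_quot pres_eq}.
HB.instance Definition _ := Choice.on pres_sort.

Definition pclass (s : seq (k * X)) : pres_sort := \pi s.

Lemma pclassP s t :
  (forall (U : lmodType k) (f : X -> U), good f -> fsum f s = fsum f t) <->
  pclass s = pclass t.
Proof.
split=> [e | /eqP]; first by apply/eqmodP/asboolP.
by rewrite /pclass eqmodE => /asboolP.
Qed.

(* The linear extension of [f], computed on a formal sum representing [x]; by
   [peval_pclass] it does not depend on the representative when [f] is good. *)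
Definition peval (U : lmodType k) (f : X -> U) (x : pres_sort) : U :=
  fsum f (repr x).

Lemma peval_pclass (U : lmodType k) (f : X -> U) s :
  good f -> peval f (pclass s) = fsum f s.
Proof. by move=> fg; apply: (pclassP _ _).2 fg; rewrite /pclass reprK. Qed.

Let add x y := pclass (repr (x : pres_sort) ++ repr (y : pres_sort)).
Let scale c x := pclass (fscale c (repr (x : pres_sort))).
Let opp := scale (-1).

Let pres_ext x y :
  (forall (U : lmodType k) (f : X -> U), good f -> peval f x = peval f y) ->
  x = y.
Proof. by move=> e; rewrite -[x]reprK -[y]reprK; apply/pclassP. Qed.

Let peval_add (U : lmodType k) (f : X -> U) : good f ->
  {morph peval f : x y / add x y >-> x + y}.
Proof. by move=> fg x y; rewrite peval_pclass // fsum_cat. Qed.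

Let peval_scale (U : lmodType k) (f : X -> U) c : good f ->
  {morph peval f : x / scale c x >-> c *: x}.
Proof. by move=> fg x; rewrite peval_pclass // fsum_scale. Qed.

Let peval_zero (U : lmodType k) (f : X -> U) : good f -> peval f (pclass [::]) = 0.
Proof. by move=> fg; rewrite peval_pclass // /fsum big_nil. Qed.

Let addA : associative add.
Proof. by move=> x y z; apply: pres_ext => U f fg; rewrite !peval_add // addrA. Qed.
Let addC : commutative add.
Proof. by move=> x y; apply: pres_ext => U f fg; rewrite !peval_add // addrC. Qed.
Let add0 : left_id (pclass [::]) add.
Proof.
by move=> x; apply: pres_ext => U f fg; rewrite peval_add ?peval_zero ?add0r.
Qed.
Let addN : left_inverse (pclass [::]) opp add.
Proof.
move=> x; apply: pres_ext => U f fg.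
by rewrite peval_add // peval_scale // peval_zero // scaleN1r addNr.
Qed.
HB.instance Definition _ := GRing.isZmodule.Build pres_sort addA addC add0 addN.

Let scaleA a b x : scale a (scale b x) = scale (a * b) x.
Proof. by apply: pres_ext => U f fg; rewrite !peval_scale // scalerA. Qed.
Let scale1 : left_id 1 scale.
Proof. by move=> x; apply: pres_ext => U f fg; rewrite peval_scale // scale1r. Qed.
Let scaleDr : right_distributive scale +%R.
Proof.
move=> c x y; apply: pres_ext => U f fg.
by rewrite peval_scale // !peval_add // !peval_scale // scalerDr.
Qed.
Let scaleDl x : {morph scale^~ x : a b / a + b}.
Proof.
move=> a b; apply: pres_ext => U f fg.
by rewrite peval_add // !peval_scale // scalerDl.
Qed.
HB.instance Definition _ := GRing.Zmodule_isLmodule.Build k pres_sort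
  scaleA scale1 scaleDr scaleDl.

Definition pres : lmodType k := pres_sort.

Definition pgen (x : X) : pres := pclass [:: (1, x)].

Lemma peval_linear (U : lmodType k) (f : X -> U) :
  good f -> linear (peval f : pres -> U).
Proof. by move=> fg c x y; rewrite peval_add // peval_scale. Qed.

Lemma peval0 (U : lmodType k) (f : X -> U) : good f -> peval f (0 : pres) = 0.
Proof. exact: peval_zero. Qed.

Lemma peval_pgen (U : lmodType k) (f : X -> U) x :
  good f -> peval f (pgen x) = f x.
Proof. by move=> fg; rewrite peval_pclass // /fsum big_seq1 scale1r. Qed.

Lemma presP (x y : pres) :
  (forall (U : lmodType k) (f : X -> U), good f -> peval f x = peval f y) ->
  x = y.
Proof. exact: pres_ext. Qed.

Lemma pclass_fsum (s : seq (k * X)) : pclass s = fsum pgen s :> pres.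
Proof.
apply: presP => U f fg; rewrite peval_pclass //.
have evD : {morph (peval f : pres -> U) : x y / x + y} := peval_add fg.
have ev0 := peval0 fg.
rewrite /fsum (big_morph _ evD ev0); apply: eq_bigr => p _.
by rewrite -[X in _ *: X](peval_pgen _ fg) -peval_scale.
Qed.

End Presentation.

Definition bilin (k : fieldType) (V W U : lmodType k) (f : V -> W -> U) : Prop :=
  (forall w, linear (f^~ w)) /\ (forall v, linear (f v)).

Definition tensor (k : fieldType) (V W : lmodType k) : lmodType k :=
  @pres k (V * W)%type (fun U f => bilin (fun v w => f (v, w))).

Definition tens (k : fieldType) (V W : lmodType k) (v : V) (w : W) :
  tensor V W := pgen _ (v, w).

Notation "V ⊠ W" := (tensor V W) (at level 40, left associativity) : type_scope.
Notation "v ⊗ w" := (tens v w) (at level 40, left associativity) : ring_scope.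

(* Sweedler notation: [\swd_(x, y <- t) E] is the value at [t] of the linear map
   [x ⊗ y |-> E]. *)
Definition sweedler (k : fieldType) (V W U : lmodType k) (t : V ⊠ W)
  (f : V -> W -> U) : U := peval (fun p : V * W => f p.1 p.2) t.

Notation "\swd_ ( x , y <- t ) E" := (sweedler t (fun x y => E))
  (at level 41, E at level 41, x name, y name, t at level 60,
   format "'[' \swd_ ( x ,  y  <-  t ) '/  '  E ']'") : ring_scope.

Lemma tens_bilin (k : fieldType) (V W : lmodType k) : bilin (@tens k V W).
Proof.
split=> u c x y; apply: presP => U f fg; rewrite (peval_linear fg) !peval_pgen //.
  exact: fg.1.
exact: fg.2.
Qed.

Lemma sweedler_linear (k : fieldType) (V W U : lmodType k) (f : V -> W -> U) :
  bilin f -> linear (fun t => \swd_(x, y <- t) f x y).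
Proof. by move=> fb; apply: peval_linear. Qed.

Lemma sweedler_tens (k : fieldType) (V W U : lmodType k) (f : V -> W -> U) v w :
  bilin f -> \swd_(x, y <- v ⊗ w) f x y = f v w.
Proof. by move=> fb; rewrite /sweedler peval_pgen. Qed.

HB.mixin Record isHopfAlgebra (k : fieldType) A of GRing.Algebra k A := {
  comul : {linear A -> A ⊠ A};
  counit : {scalar A};
  antipode : {linear A -> A};
  comulA : forall a : A,
    \swd_(x, y <- comul a) \swd_(x1, x2 <- comul x) (x1 ⊗ (x2 ⊗ y)) =
    \swd_(x, y <- comul a) (x ⊗ comul y);
  counitl : forall a : A, \swd_(x, y <- comul a) (counit x *: y) = a;
  counitr : forall a : A, \swd_(x, y <- comul a) (counit y *: x) = a;
  comul1 : comul 1 = 1 ⊗ 1;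
  comulM : forall a b : A, comul (a * b) =
    \swd_(a1, a2 <- comul a) \swd_(b1, b2 <- comul b) (a1 * b1) ⊗ (a2 * b2);
  counit1 : counit 1 = 1;
  counitM : forall a b : A, counit (a * b) = counit a * counit b;
  antipodel : forall a : A,
    \swd_(x, y <- comul a) (antipode x * y) = counit a *: 1;
  antipoder : forall a : A,
    \swd_(x, y <- comul a) (x * antipode y) = counit a *: 1
}.

#[short(type="hopfType")]
HB.structure Definition HopfAlgebra (k : fieldType) :=
  {A of GRing.Algebra k A & isHopfAlgebra k A}.

Definition hopf_pairing (k : fieldType) (A H : hopfType k) (pair : A -> H -> k) :
  Prop :=
  bilin (pair : A -> H -> k^o) /\
  [/\ forall a b h, pair (a * b) h =
        \swd_(h1, h2 <- comul h) (pair a h1 * pair b h2 : k^o),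
      forall a h g, pair a (h * g) =
        \swd_(a1, a2 <- comul a) (pair a1 h * pair a2 g : k^o),
      forall h, pair 1 h = counit h,
      forall a, pair a 1 = counit a &
      forall a h, pair (antipode a) h = pair a (antipode h)].

Definition nondegenerate_pairing (k : fieldType) (A H : lmodType k) (pair : A -> H -> k) :
  Prop :=
  (forall a, (forall h, pair a h = 0) -> a = 0) /\
  (forall h, (forall a, pair a h = 0) -> h = 0).

Record crossed_ops (k : fieldType) (A V : lmodType k) := CrossedOps {
  ract : V -> A -> V;
  rcoact : V -> V ⊠ A
}.

Section CrossedModules.
Variables (k : fieldType) (A : hopfType k).

Definition is_right_action (V : lmodType k) (act : V -> A -> V) : Prop :=
  [/\ bilin act, forall v, act v 1 = v &
      forall v a b, act (act v a) b = act v (a * b)].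

Definition is_right_coaction (V : lmodType k) (coact : V -> V ⊠ A) : Prop :=
  [/\ linear coact,
      forall v, \swd_(v0, v1 <- coact v) (counit v1 *: v0) = v &
      forall v,
        \swd_(v0, v1 <- coact v) \swd_(v00, v01 <- coact v0) (v00 ⊗ (v01 ⊗ v1)) =
        \swd_(v0, v1 <- coact v) (v0 ⊗ comul v1)].

Definition is_crossed (V : lmodType k) (X : crossed_ops A V) : Prop :=
  [/\ is_right_action (ract X), is_right_coaction (rcoact X) &
      forall v a, rcoact X (ract X v a) =
        \swd_(v0, v1 <- rcoact X v)
          \swd_(a1, a23 <- comul a) \swd_(a2, a3 <- comul a23)
            ract X v0 a2 ⊗ (antipode a1 * v1 * a3)].

Definition crossed_map (V W : lmodType k) (X : crossed_ops A V)
    (Y : crossed_ops A W) (f : V -> W) : Prop :=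
  [/\ linear f, forall v a, f (ract X v a) = ract Y (f v) a &
      forall v, rcoact Y (f v) = \swd_(v0, v1 <- rcoact X v) (f v0 ⊗ v1)].

Definition aug : {pred A} := fun a => counit a == 0.

Fact aug_submod_closed : GRing.subsemimod_closed aug.
Proof.
split; first split.
- by rewrite unfold_in linear0.
- by move=> a b /eqP ea /eqP eb; rewrite unfold_in linearD ea eb /= addr0.
- by move=> c a /eqP ea; rewrite unfold_in linearZ /= ea mulr0.
Qed.
HB.instance Definition _ := GRing.isSubmodClosed.Build k A aug aug_submod_closed.

Record Aplus := MkAplus { aplus_val : A; _ : aplus_val \in aug }.
HB.instance Definition _ := [isSub for aplus_val].
HB.instance Definition _ := [Choice of Aplus by <:].
HB.instance Definition _ := [SubChoice_isSubLmodule of Aplus by <:].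

Fact aug_proj_subproof a : a - counit a *: 1 \in aug.
Proof. by rewrite unfold_in linearB linearZ /= counit1 mulr1 subrr. Qed.
Definition aug_proj (a : A) : Aplus := MkAplus (aug_proj_subproof a).

Fact aplus_mul_subproof (a : Aplus) (b : A) : val a * b \in aug.
Proof. by case: a => a /= /eqP ea; rewrite unfold_in counitM ea mul0r. Qed.
Definition aplus_mul (a : Aplus) (b : A) : Aplus := MkAplus (aplus_mul_subproof a b).

(* The coaction is [a |-> a2 ⊗ S(a1) a3].  It takes its values in [Aplus ⊠ A],
   but the individual [a2] need not lie in [Aplus]; replacing them by their
   projection [a2 - counit a2 *: 1] does not change the sum, because
   [counit a2 *: (1 ⊗ S(a1) a3)] sums to [counit a *: (1 ⊗ 1) = 0]. *)
Definition aplus_coact (a : Aplus) : Aplus ⊠ A :=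
  \swd_(a1, a23 <- comul (val a)) \swd_(a2, a3 <- comul a23)
    aug_proj a2 ⊗ (antipode a1 * a3).

Definition aplus_ops : crossed_ops A Aplus := CrossedOps aplus_mul aplus_coact.

End CrossedModules.

Definition mutually_adjoint (k : fieldType) (A H : hopfType k)
    (pair : A -> H -> k) (V : vectType k)
    (X : crossed_ops A V) (Y : crossed_ops H 'Hom(V, k^o)) : Prop :=
  (forall (phi : 'Hom(V, k^o)) (v : V) (h : H),
     ract Y phi h v = \swd_(v0, v1 <- rcoact X v) (phi v0 * pair v1 h : k^o)) /\
  (forall (phi : 'Hom(V, k^o)) (v : V) (a : A),
     phi (ract X v a) =
     \swd_(phi0, phi1 <- rcoact Y phi) (phi0 v * pair a phi1 : k^o)).

(** [talg V] is spanned by words in [V], multilinear in the letters; the words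
    of length [n] span the n-th tensor power of [V]. *)

Definition multilin (k : fieldType) (V U : lmodType k) (f : seq V -> U) : Prop :=
  forall s t, linear (fun v => f (s ++ v :: t)).

Definition talg (k : fieldType) (V : lmodType k) : lmodType k :=
  @pres k (seq V) (fun U f => multilin f).

Section TensorAlgebra.
Variables (k : fieldType) (V : lmodType k).
Local Notation T := (talg V).

Definition word (s : seq V) : T := pgen _ s.

Definition tlift (U : lmodType k) (f : seq V -> U) (x : T) : U := peval f x.

Lemma word_multilin : multilin word.
Proof.
move=> s t c v w; apply: presP => U f fg.
by rewrite (peval_linear fg) !peval_pgen //; apply: fg.
Qed.

Definition tmul (x y : T) : T :=
  tlift (fun s => tlift (fun t => word (s ++ t)) y) x.

Definition thomog (n : nat) (x : T) : Prop :=
  exists2 s : seq (k * seq V), all (fun p => size p.2 == n) s &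
    x = \sum_(p <- s) p.1 *: word p.2.

Definition tparity (x : T) : T := tlift (fun s => (-1) ^+ size s *: word s) x.

(* [id ⊗ F], with [id] on the first tensor factor. *)
Definition tshift (F : T -> T) (x : T) : T :=
  tlift (fun s => if s is v :: s' then tmul (word [:: v]) (F (word s')) else 0) x.

(* For [B : V ⊠ V -> V ⊠ V], [tbraid B i] is [B] acting in the tensor factors
   [i, i+1], counted from 0. *)
Fixpoint tbraid (B : V ⊠ V -> V ⊠ V) (i : nat) : T -> T :=
  if i is j.+1 then tshift (tbraid B j) else
  tlift (fun s => if s is v :: w :: s'
                  then \swd_(x, y <- B (v ⊗ w)) word (x :: y :: s') else 0).

(* [n, B] = id + B_1 + B_1 B_2 + ... + B_1 ... B_(n-1) *)
Definition braided_int (B : V ⊠ V -> V ⊠ V) (n : nat) (x : T) : T :=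
  \sum_(m < n) foldr (fun i y => tbraid B i y) x (iota 0 m).

(* [n, B]! = (id ⊗ [n-1, B]!) [n, B] *)
Fixpoint braided_fact (B : V ⊠ V -> V ⊠ V) (n : nat) (x : T) : T :=
  if n is m.+1 then tshift (braided_fact B m) (braided_int B m.+1 x) else x.

End TensorAlgebra.

Section BraidedExterior.
Variables (k : fieldType) (A : hopfType k) (V : lmodType k).
Variable X : crossed_ops A V.
Local Notation T := (talg V).

Definition Psi (t : V ⊠ V) : V ⊠ V :=
  \swd_(v, w <- t) \swd_(w0, w1 <- rcoact X w) w0 ⊗ ract X v w1.

Definition negPsi (t : V ⊠ V) : V ⊠ V := - Psi t.

(* The action and coaction of the tensor powers of [V] in the monoidal category
   of crossed modules. *)
Fixpoint wact (s : seq V) (a : A) : T :=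
  if s is v :: s' then
    \swd_(a1, a2 <- comul a) tmul (word [:: ract X v a1]) (wact s' a2)
  else counit a *: word [::].

Definition tact (x : T) (a : A) : T := tlift (wact^~ a) x.

Fixpoint wcoact (s : seq V) : T ⊠ A :=
  if s is v :: s' then
    \swd_(v0, v1 <- rcoact X v) \swd_(x0, x1 <- wcoact s')
      tmul (word [:: v0]) x0 ⊗ (v1 * x1)
  else word [::] ⊗ 1.

Definition tcoact (x : T) : T ⊠ A := tlift wcoact x.

(* The super-braiding [x ⊗ y |-> (-1)^(|x||y|) y0 ⊗ x ◁ y1]. *)
Definition tsbraid (x y : T) : T ⊠ T :=
  tlift (fun s => tlift (fun t => (-1) ^+ (size s * size t) *:
    (\swd_(y0, y1 <- wcoact t) y0 ⊗ wact s y1)) y) x.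

Definition tsmul2 (p q : T ⊠ T) : T ⊠ T :=
  \swd_(a, b <- p) \swd_(c, d <- q) \swd_(c', b' <- tsbraid b c)
    tmul a c' ⊗ tmul b' d.

(* The coproduct: multiplicative for the super-braided product of [T ⊠ T], the
   elements of [V] being primitive. *)
Fixpoint wcomul (s : seq V) : T ⊠ T :=
  if s is v :: s' then
    tsmul2 (word [:: v] ⊗ word [::] + word [::] ⊗ word [:: v]) (wcomul s')
  else word [::] ⊗ word [::].

Definition tcomul (x : T) : T ⊠ T := tlift wcomul x.

(* [B_-], the quotient of [T] by the span of all the kernels of [n, -Psi]! in
   degree [n]. *)
Definition bker (x : T) : Prop :=
  exists2 n, thomog n x & braided_fact negPsi n x = 0.

Definition bext : lmodType k :=
  @pres k T (fun U f => linear f /\ forall x, bker x -> f x = 0).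
Local Notation B := bext.

Definition bcls (x : T) : B := pgen _ x.

Lemma bcls_linear : linear bcls.
Proof.
move=> c x y; apply: presP => U f fg.
by rewrite (peval_linear fg) !peval_pgen //; apply: fg.1.
Qed.

Lemma bcls_ker x : bker x -> bcls x = 0.
Proof.
move=> xK; apply: presP => U f fg; rewrite peval_pgen // fg.2 //.
by rewrite (peval0 fg).
Qed.

(* [blift f] is the map that [f] induces on the quotient, computed on formal sums
   of representatives.  It is used for maps [f] that vanish on the kernels: this
   holds for the operations below because the span of the kernels is a Hopf
   ideal, stable under the action and coaction of [A]. *)
Definition blift (U : lmodType k) (f : T -> U) (x : B) : U := peval f x.

Definition bone : B := bcls (word [::]).
Definition bincl (v : V) : B := bcls (word [:: v]).

Definition bmul (x y : B) : B :=
  blift (fun s => blift (fun t => bcls (tmul s t)) y) x.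

Definition bact (x : B) (a : A) : B := blift (fun s => bcls (tact s a)) x.

Definition bcoact (x : B) : B ⊠ A :=
  blift (fun s => \swd_(s0, s1 <- tcoact s) bcls s0 ⊗ s1) x.

Definition bcomul (x : B) : B ⊠ B :=
  blift (fun s => \swd_(s1, s2 <- tcomul s) bcls s1 ⊗ bcls s2) x.

Definition bparity (x : B) : B := blift (fun s => bcls (tparity s)) x.

Definition bhomog (n : nat) (x : B) : Prop :=
  exists2 t, thomog n t & x = bcls t.

Definition smash : lmodType k := A ⊠ B.

Definition smul (x y : smash) : smash :=
  \swd_(a, eta <- x) \swd_(b, zeta <- y) \swd_(b1, b2 <- comul b)
    (a * b1) ⊗ bmul (bact eta b2) zeta.

Definition scomul (x : smash) : smash ⊠ smash :=
  \swd_(a, eta <- x) \swd_(a1, a2 <- comul a)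
    \swd_(eta1, eta2 <- bcomul eta) \swd_(f0, f1 <- bcoact eta1)
      (a1 ⊗ f0) ⊗ ((a2 * f1) ⊗ eta2).

Definition sparity (x : smash) : smash := \swd_(a, eta <- x) a ⊗ bparity eta.

Definition shomog (n : nat) (x : smash) : Prop :=
  exists2 s : seq (A * B), (forall p, p \in s -> bhomog n p.2) &
    x = \sum_(p <- s) p.1 ⊗ p.2.

(* With [sparity x = (-1)^|x| x] on homogeneous elements. *)
Definition super_derivation (d : smash -> smash) : Prop :=
  forall x y, d (smul x y) = smul (d x) y + smul (sparity x) (d y).

Definition super_coderivation (d : smash -> smash) : Prop :=
  forall x, scomul (d x) =
    \swd_(x1, x2 <- scomul x) (d x1 ⊗ x2 + sparity x1 ⊗ d x2).

Definition strongly_bicovariant (d : smash -> smash) : Prop :=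
  [/\ linear d, forall n x, shomog n x -> shomog n.+1 (d x),
      forall x, d (d x) = 0, super_derivation d & super_coderivation d].

Definition extends_calculus (omega : Aplus A -> V) (d : smash -> smash) : Prop :=
  forall a, d (a ⊗ bone) =
    \swd_(a1, a2 <- comul a) a1 ⊗ bincl (omega (aug_proj a2)).

Definition bsuper_derivation1 (delta : B -> B) : Prop :=
  [/\ linear delta, forall n x, bhomog n x -> bhomog n.+1 (delta x) &
      forall x y, delta (bmul x y) =
        bmul (delta x) y + bmul (bparity x) (delta y)].

(* [V ⊠ V] as the degree 2 part of [T], and its product in [B_-]. *)
Definition tdeg2 (t : V ⊠ V) : T := \swd_(v, w <- t) word [:: v; w].
Definition bprod2 (t : V ⊠ V) : B := \swd_(v, w <- t) bmul (bincl v) (bincl w).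

Definition is_preimage (omega : Aplus A -> V) (eta : V) (th : V ⊠ V) : Prop :=
  braided_int negPsi 2 (tdeg2 th) =
  tdeg2 (\swd_(eta0, eta1 <- rcoact X eta) eta0 ⊗ omega (aug_proj eta1)).

End BraidedExterior.

(* Main.v *)
(** With [F n] for [[n, -Psi]!], the factorisations [F (n+1) = P (id ⊗ F n)] and
    [F (n+1) = Q (F n ⊗ id)] show that the kernels of the [F n] span an ideal of the
    tensor algebra; the first follows from far commutativity alone, the second uses
    the braid relation.  As [Psi] is [A]-linear, the ideal is stable under [A].
    This makes the product and action of [B_-] well defined.

    Of the coproduct and the coaction only the components of degree at most 1 in
    each factor are needed.  Let [d] be a differential.  Projecting the first factor
    of [Delta d = (d ⊗ id + (-1)^| | ⊗ d) Delta] to degree 0 shows that [d] commutes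
    with the left coaction of [A], hence [d (1 ⊗ eta) = 1 ⊗ delta eta] with [delta] a
    super-derivation.  Projecting both factors to degree 1, for [eta] of degree 1,
    gives [(id - Psi) (delta eta) = - eta_0 ⊗ omega (pi eta_1)], where the left side
    is well defined because degree 2 of [B_-] is the quotient by [ker (id - Psi)];
    for the same reason this equation determines [delta eta].  Uniqueness follows
    since [B_-] is generated in degree 1. *)

(* All spaces are given by generators and relations, and a Sweedler sum runs over a chosen formal
   sum that represents the tensor. Linear maps can therefore be moved into such sums freely, but
   evaluating a sum at a pure tensor, or an induced map at a class, asks for multilinearity; the
   tactic [lin] discharges these goals.

   The operators -Psi_i are treated abstractly, as additive maps [b i] of an abelian group that
   commute when far apart and satisfy the braid relation. Then [n, -Psi]! is the sum over all
   permutations of reduced products of the [b i], and P and Q are the sums over minimal coset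
   representatives of S_n in S_(n+1), where S_n permutes the last, respectively the first, n places.

   In bidegree (1,1) each term of the coderivation property applies [d] to a factor of degree 0,
   where [d] is the given calculus. In [d ⊗ id] this factor is 1, and pi(1) = 0; in (-1)^| | ⊗ d it
   carries the coaction of eta, and the sign of the other factor, which has degree 1, is the minus
   sign of the formula. *)
Require Import Defs.
From HB Require Import structures.
From mathcomp Require Import all_boot all_order all_algebra.
From mathcomp Require Import zify.

Import GRing.Theory.
Local Open Scope ring_scope.

Set Implicit Arguments.
Unset Strict Implicit.
Unset Printing Implicit Defensive.

(* [linear] as a constant of its own, on which the tactic [lin] can match. *)
Definition lin (k : fieldType) (U V : lmodType k) (f : U -> V) : Prop :=
  forall c x y, f (c *: x + y) = c *: f x + f y.

(** * Linear maps, and a tactic for linearity goals *)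

Section Linear.
Variable k : fieldType.
Implicit Types U V W X : lmodType k.

Lemma lin_id U : lin (fun x : U => x). Proof. by []. Qed.

Lemma lin_comp U V W (g : V -> W) (h : U -> V) :
  lin g -> lin h -> lin (fun x => g (h x)).
Proof. by move=> gl hl c x y; rewrite hl gl. Qed.

Lemma lin0 U V (f : U -> V) : lin f -> f 0 = 0.
Proof.
move=> fl; apply: (addrI (f 0)); rewrite addr0.
by have := fl 1 0 0; rewrite !scale1r addr0 => <-.
Qed.

Lemma linD U V (f : U -> V) : lin f -> {morph f : x y / x + y}.
Proof. by move=> fl x y; rewrite -[x]scale1r fl !scale1r. Qed.

Lemma linZ U V (f : U -> V) c x : lin f -> f (c *: x) = c *: f x.
Proof. by move=> fl; rewrite -[c *: x]addr0 fl (lin0 fl) addr0. Qed.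

Lemma linN U V (f : U -> V) x : lin f -> f (- x) = - f x.
Proof. by move=> fl; rewrite -scaleN1r linZ // scaleN1r. Qed.

Lemma linB U V (f : U -> V) x y : lin f -> f (x - y) = f x - f y.
Proof. by move=> fl; rewrite linD // linN. Qed.

Lemma lin_sum U V (f : U -> V) I (r : seq I) (F : I -> U) :
  lin f -> f (\sum_(i <- r) F i) = \sum_(i <- r) f (F i).
Proof. by move=> fl; apply: (big_morph f (linD fl) (lin0 fl)). Qed.

Lemma lin_zero U V : lin (fun _ : U => 0 : V).
Proof. by move=> c x y; rewrite scaler0 addr0. Qed.

Lemma lin_add U V (f g : U -> V) : lin f -> lin g -> lin (fun x => f x + g x).
Proof. by move=> fl gl c x y; rewrite fl gl scalerDr addrACA. Qed.

Lemma lin_opp U V (f : U -> V) : lin f -> lin (fun x => - f x).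
Proof. by move=> fl c x y; rewrite fl opprD scalerN. Qed.

Lemma lin_scale U V a (f : U -> V) : lin f -> lin (fun x => a *: f x).
Proof. by move=> fl c x y; rewrite fl scalerDr !scalerA mulrC. Qed.

Lemma lin_scalel U V (f : U -> k^o) (v : V) : lin f -> lin (fun x => f x *: v).
Proof. by move=> fl c x y; rewrite fl scalerDl scalerA. Qed.

Lemma lin_bill U V W X (g : V -> W -> X) (h : U -> V) w :
  bilin g -> lin h -> lin (fun x => g (h x) w).
Proof. by move=> [gl _] hl c x y; rewrite hl; apply: gl. Qed.

Lemma lin_bilr U V W X (g : W -> V -> X) (h : U -> V) w :
  bilin g -> lin h -> lin (fun x => g w (h x)).
Proof. by move=> [_ gl] hl c x y; rewrite hl; apply: gl. Qed.

Lemma lin_sweedler U V W X (t : U -> V ⊠ W) (f : V -> W -> X) :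
  bilin f -> lin t -> lin (fun x => sweedler (t x) f).
Proof. by move=> fb tl c x y; rewrite tl; apply: sweedler_linear fb _ _ _. Qed.

(** The representative of [t] stays fixed while [x] varies, so linearity in [x] holds even for
    summands that are not bilinear in [v] and [w]. *)
Lemma lin_sweedler_fun U V W X (t : V ⊠ W) (f : U -> V -> W -> X) :
  (forall v w, lin (fun x => f x v w)) -> lin (fun x => sweedler t (f x)).
Proof.
move=> fl c x y; rewrite /sweedler /peval /fsum scaler_sumr -big_split /=.
by apply: eq_bigr => p _; rewrite fl scalerDr !scalerA mulrC.
Qed.

Lemma bilinP V W X (g : V -> W -> X) :
  (forall w, lin (fun v => g v w)) -> (forall v, lin (fun w => g v w)) ->
  bilin g.
Proof. by []. Qed.

End Linear.

Create HintDb lin.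
#[export] Hint Resolve tens_bilin : lin.

(* Extended below with the rules for the letters of a word and for the operations
   of a Hopf algebra. *)
Ltac lin_word := fail.

(** In a Sweedler sum the variable occurs either in the tensor or in the summand, and the two cases
    need different rules. Words are left to [lin_word], because a word is linear in a letter and not
    in the list that the generic rules would see. *)
Ltac lin :=
  intros; cbv beta;
  lazymatch goal with
  | |- bilin _ => first [ solve [auto with lin nocore] | apply: bilinP; lin ]
  | |- linear ?f => change (lin f); lin
  | |- lin _ => first
    [ solve [auto with lin nocore]
    | match goal with
      | |- lin (fun x => x) => apply: lin_id
      | |- lin (fun x => 0) => apply: lin_zero
      | |- lin (fun x => @?f x + @?g x) => apply: (lin_add (f := f) (g := g)); lin
      | |- lin (fun x => - @?f x) => apply: (lin_opp (f := f)); lin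
      | |- lin (fun x => ?c *: @?f x) => apply: (lin_scale c (f := f)); lin
      | |- @lin _ ?U ?W (fun x => @?f x *: ?v) => refine (@lin_scalel _ U W f v _); lin
      | |- lin (fun x => sweedler (@?t x) ?f) =>
          apply: (lin_sweedler (t := t) (f := f)); lin
      | |- lin (fun x => sweedler ?t (@?f x)) =>
          apply: (lin_sweedler_fun t (f := f)); lin
      | |- _ => lin_word; lin
      | |- lin (?g ?w) => apply: (lin_bilr (g := g) w); [solve [auto with lin nocore] | apply: lin_id]
      | |- lin (fun x => ?g ?w (@?h x)) =>
          apply: (lin_bilr (g := g) (h := h) w); [solve [auto with lin nocore] | lin]
      | |- lin (fun x => ?g (@?h x)) =>
          apply: (lin_comp (g := g) (h := h)); [solve [auto with lin nocore] | lin]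
      | |- lin (fun x => ?g (@?h x) ?w) =>
          apply: (lin_bill (g := g) (h := h) w); [solve [auto with lin nocore] | lin]
      end ]
  end.

(** * Sweedler calculus *)

Section Sweedler.
Variable k : fieldType.
Implicit Types U V W X : lmodType k.

(** Both sides sum over the same representative of [t], so this is congruence of finite sums, also
    for summands that are not bilinear. *)
Lemma eq_swd V W U (t : V ⊠ W) (f g : V -> W -> U) :
  (forall v w, f v w = g v w) -> sweedler t f = sweedler t g.
Proof. by move=> e; apply: eq_bigr => p _ /=; rewrite e. Qed.

Lemma lin_swd V W U U' (t : V ⊠ W) (f : V -> W -> U) (g : U -> U') :
  lin g -> g (sweedler t f) = \swd_(v, w <- t) g (f v w).
Proof.
move=> gl; rewrite /sweedler /peval /fsum lin_sum //.
by apply: eq_bigr => p _; rewrite linZ.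
Qed.

Lemma swdD V W U (t : V ⊠ W) (f g : V -> W -> U) :
  \swd_(v, w <- t) (f v w + g v w) = sweedler t f + sweedler t g.
Proof.
rewrite /sweedler /peval /fsum -big_split /=.
by apply: eq_bigr => p _; rewrite scalerDr.
Qed.

Lemma swdZ V W U (t : V ⊠ W) (f : V -> W -> U) c :
  \swd_(v, w <- t) (c *: f v w) = c *: sweedler t f.
Proof. by rewrite (lin_swd _ _ (g := fun x => c *: x)) //; lin. Qed.

Lemma swdN V W U (t : V ⊠ W) (f : V -> W -> U) :
  \swd_(v, w <- t) (- f v w) = - sweedler t f.
Proof. by rewrite (lin_swd _ _ (g := fun x => - x)) //; lin. Qed.

Lemma swd0 V W U (t : V ⊠ W) : \swd_(v, w <- t) (0 : U) = 0.
Proof. by rewrite /sweedler /peval /fsum big1 // => p _; rewrite scaler0. Qed.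

Lemma swd_swd V W V' W' U (t : V ⊠ W) (f : V -> W -> V' ⊠ W') (g : V' -> W' -> U) :
  bilin g ->
  sweedler (sweedler t f) g = \swd_(v, w <- t) sweedler (f v w) g.
Proof. by move=> gb; rewrite (lin_swd _ _ (g := fun x => sweedler x g)) //; lin. Qed.

Lemma exchange_swd V W V' W' U (t : V ⊠ W) (t' : V' ⊠ W')
    (f : V -> W -> V' -> W' -> U) :
  \swd_(v, w <- t) \swd_(v', w' <- t') f v w v' w' =
  \swd_(v', w' <- t') \swd_(v, w <- t) f v w v' w'.
Proof.
rewrite /sweedler /peval /fsum.
under eq_bigr do rewrite scaler_sumr.
rewrite exchange_big; apply: eq_bigr => p _ /=.
by rewrite scaler_sumr; apply: eq_bigr => q _; rewrite !scalerA mulrC.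
Qed.

Lemma tensor_sum V W (t : V ⊠ W) :
  exists s : seq (k * (V * W)), t = \sum_(p <- s) p.1 *: (p.2.1 ⊗ p.2.2).
Proof.
exists (repr t); rewrite -[LHS]reprK.
rewrite [LHS](pclass_fsum (fun U f => bilin (fun v w => f (v, w)))).
by apply: eq_bigr => -[c [v w]].
Qed.

Lemma tensor_ext V W U (f g : V ⊠ W -> U) :
  lin f -> lin g -> (forall v w, f (v ⊗ w) = g (v ⊗ w)) -> f =1 g.
Proof.
move=> fl gl e t; have [s ->] := tensor_sum t.
by rewrite !lin_sum //; apply: eq_bigr => p _; rewrite !linZ // e.
Qed.

Lemma swd_tens V W U (f : V -> W -> U) v w : bilin f -> sweedler (v ⊗ w) f = f v w.
Proof. exact: sweedler_tens. Qed.

Lemma swd_tensD V W U (f : V -> W -> U) v w v' w' :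
  bilin f -> sweedler (v ⊗ w + v' ⊗ w') f = f v w + f v' w'.
Proof.
move=> fb; have fl := sweedler_linear fb.
by rewrite (linD (f := fun t => sweedler t f)) // !swd_tens.
Qed.

Lemma swd_id V W (t : V ⊠ W) : \swd_(v, w <- t) v ⊗ w = t.
Proof.
apply: (tensor_ext (f := fun t => \swd_(v, w <- t) v ⊗ w) (g := id)) => [||v w].
- by lin.
- exact: lin_id.
- by rewrite swd_tens //; lin.
Qed.

End Sweedler.

(** * Braided integers and factorials *)

Section Factorials.
Variables (T : zmodType) (b : nat -> T -> T).
Hypothesis bD : forall i, {morph b i : x y / x + y}.

(* [bint j n] is [n, B] shifted by [j] places, and [bintr j n] has the factors of
   every product in the opposite order. *)
Fixpoint bint (j n : nat) (x : T) : T :=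
  if n is m.+1 then x + b j (bint j.+1 m x) else 0.

Fixpoint bintr (j n : nat) (x : T) : T :=
  if n is m.+1 then x + bintr j.+1 m (b j x) else 0.

Fixpoint bfact (j n : nat) (x : T) : T :=
  if n is m.+1 then bfact j.+1 m (bint j m.+1 x) else x.

Fixpoint bcycle (j n : nat) (x : T) : T :=
  if n is m.+1 then b j (bcycle j.+1 m x) else x.

(** With l = j + n - 1 this is 1 + b_l + b_(l-1) b_l + ... + b_j ... b_l, the left factor Q of
    [bfactSr]; the longest product is split off so that the recursion raises [j], as in [bfact]. *)
Fixpoint bcosets (j n : nat) (x : T) : T :=
  if n is m.+1 then bcosets j.+1 m x + bcycle j n x else x.

Let b0 i : b i 0 = 0.
Proof. by apply: (addrI (b i 0)); rewrite -bD !addr0. Qed.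

Lemma bintD j n : {morph bint j n : x y / x + y}.
Proof.
elim: n j => [|n IHn] j x y /=; first by rewrite addr0.
by rewrite IHn bD addrACA.
Qed.

Lemma bintrD j n : {morph bintr j n : x y / x + y}.
Proof.
elim: n j => [|n IHn] j x y /=; first by rewrite addr0.
by rewrite bD IHn addrACA.
Qed.

Lemma bfactD j n : {morph bfact j n : x y / x + y}.
Proof.
elim: n j => [//|n IHn] j x y.
by rewrite -[bfact _ _ _]/(bfact _ _ (bint _ _ _)) bintD IHn.
Qed.

Lemma bcycleD j n : {morph bcycle j n : x y / x + y}.
Proof. by elim: n j => [//|n IHn] j x y /=; rewrite IHn bD. Qed.

Lemma bintr0 j n : bintr j n 0 = 0.
Proof. by apply: (addrI (bintr j n 0)); rewrite -bintrD !addr0. Qed.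

Lemma bcosets0 j n : bcosets j n 0 = 0.
Proof.
have c0 i m : bcycle i m 0 = 0.
  by apply: (addrI (bcycle i m 0)); rewrite -bcycleD !addr0.
by elim: n j => [//|n IHn] j; rewrite /= IHn -/(bcycle j n.+1 0) c0 addr0.
Qed.

Lemma bintSr j n x : bint j n.+1 x = bint j n x + bcycle j n x.
Proof.
elim: n j => [|n IHn] j; first by rewrite /= b0 addrC.
by rewrite -[LHS]/(x + b j (bint j.+1 n.+1 x)) IHn bD addrA.
Qed.

Lemma bint_foldr j n x :
  bint j n x = \sum_(m < n) foldr (fun i y => b i y) x (iota j m).
Proof.
elim: n j => [|n IHn] j /=; first by rewrite big_ord0.
rewrite big_ord_recl /= IHn; congr (_ + _).
by rewrite (big_morph _ (bD j) (b0 j)).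
Qed.

Section Commute.
Variables (f : T -> T) (j n : nat) (S : T -> Prop).
Hypothesis fD : {morph f : x y / x + y}.
Hypothesis SD : forall x y, S x -> S y -> S (x + y).
Hypothesis S0 : S 0.

(* The operators [b i] that occur in [bfact j n] are those with
   [j <= i < j + n - 1]. *)
Hypothesis Sb : forall i x, (j <= i)%N -> (i.+1 < j + n)%N -> S x -> S (b i x).
Variable s : nat.
Hypothesis fb : forall i x, (j <= i)%N -> (i.+1 < j + n)%N -> S x -> f (b i x) = b (s + i)%N (f x).

Let f0 : f 0 = 0.
Proof. by apply: (addrI (f 0)); rewrite -fD !addr0. Qed.

Let bint_comm i m x : (j <= i)%N -> (i + m <= j + n)%N -> S x ->
  S (bint i m x) /\ f (bint i m x) = bint (s + i)%N m (f x).
Proof.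
elim: m i x => [|m IHm] i x ji imn Sx //=.
(* With a single term, [b i] is applied only to 0; the index [i] may then lie outside the range of
   [Sb] and [fb]. *)
case: m => [|m] in IHm imn *; first by rewrite /= !b0 !addr0.
have [||S1 e1] := IHm i.+1 x _ _ Sx; [lia|lia|].
split; first by apply: SD => //; apply: Sb => //; lia.
by rewrite fD fb ?e1 ?addnS //; lia.
Qed.

Let bfact_comm i m x : (j <= i)%N -> (i + m <= j + n)%N -> S x ->
  S (bfact i m x) /\ f (bfact i m x) = bfact (s + i)%N m (f x).
Proof.
elim: m i x => [|m IHm] i x ji imn Sx //.
have [S1 e1] := @bint_comm i m.+1 x ji imn Sx.
rewrite -[bfact i m.+1 x]/(bfact i.+1 m (bint i m.+1 x)).
rewrite -[bfact _ m.+1 _]/(bfact (s + i).+1 m (bint (s + i)%N m.+1 (f x))).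
by rewrite -e1 -addnS; apply: IHm => //; lia.
Qed.

(** A map that commutes with the operators up to a shift [s] of their indices does so with the
    factorial. Left multiplication by a letter has [s = 1]. Right multiplication has [s = 0], but
    commutes with [b i] only on sufficiently long words; the invariant [S] serves to restrict to
    these. *)
Lemma bfact_morph x : S x -> f (bfact j n x) = bfact (s + j)%N n (f x).
Proof. by move=> Sx; have [] := @bfact_comm j n x _ _ Sx. Qed.

End Commute.

Hypothesis b_far : forall i j x, (i.+1 < j)%N -> b i (b j x) = b j (b i x).

Lemma b_bfact i j n x : (i.+1 < j)%N -> b i (bfact j n x) = bfact j n (b i x).
Proof.
move=> ij; apply: (@bfact_morph (b i) j n (fun _ => True) _ _ _ _ 0) => // l y jl _ _.
by apply: b_far; lia.
Qed.

(** Apart from the identity, every term of [bint j] begins with [b j], which moves to the left past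
    [bfact j.+2], since the latter involves only operators of index at least [j+2]; induction turns
    what then stands on the left into [bintr]. *)
Lemma bfactSl j n x : bfact j n.+1 x = bintr j n.+1 (bfact j.+1 n x).
Proof.
elim: n j x => [|n IHn] j x; first by rewrite /= b0 !addr0.
set y := bint j.+1 n.+1 x.
have e1 : bfact j.+1 n.+1 x = bfact j.+2 n y by [].
rewrite -[LHS]/(bfact j.+1 n.+1 (x + b j y)) bfactD.
rewrite -[RHS]/(bfact j.+1 n.+1 x + bintr j.+1 n.+1 (b j (bfact j.+1 n.+1 x))).
by rewrite {3}e1 b_bfact // -IHn.
Qed.

Hypothesis b_braid :
  forall i x, b i (b i.+1 (b i x)) = b i.+1 (b i (b i.+1 x)).

(** Conjugation by the cycle b_j ... b_(j+n-1) raises indices by one. The operators far from [b i]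
    are passed by commutation, and the braid relation is used once, at the adjacent pair b_i
    b_(i+1). *)
Lemma b_bcycle i j n x : (j <= i)%N -> (i.+1 < j + n)%N ->
  b i.+1 (bcycle j n x) = bcycle j n (b i x).
Proof.
elim: n j x => [|n IHn] j x ji ijn; first lia.
have [eij|nij] := eqVneq i j.
  subst i; case: n IHn ijn => [|n] _ ijn; first lia.
  rewrite /= -b_braid; congr (b _ (b _ _)).
  have far m l : (j.+1 < m)%N -> b j (bcycle m l x) = bcycle m l (b j x).
    by elim: l m => [//|l IHl] m jm /=; rewrite b_far // IHl //; lia.
  exact: far.
rewrite /= -b_far; last lia.
by rewrite IHn //; lia.
Qed.

(** The last term of [bint] is a cycle; passing it lowers all indices of [bfact j.+1] by one, by
    [b_bcycle], which gives the last term of [bcosets]. The other terms of [bint] recombine with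
    [bfact j.+1] into a factorial, and induction applies. *)
Lemma bfactSr j n x : bfact j n.+1 x = bcosets j n (bfact j n x).
Proof.
elim: n j x => [|n IHn] j x; first by rewrite /= b0 addr0.
rewrite -[LHS]/(bfact j.+1 n.+1 (bint j n.+2 x)) bintSr bfactD IHn.
rewrite -[bcosets j n.+1 _]/(bcosets j.+1 n _ + bcycle j n.+1 _).
congr (_ + _).
rewrite -[j.+1]/(1 + j)%N; apply/esym.
apply: (@bfact_morph (bcycle j n.+1) j n.+1 (fun _ => True)) => //.
  exact: bcycleD.
by move=> i y ji ijn _; rewrite -b_bcycle.
Qed.

End Factorials.

(** * The tensor algebra *)

Section TensorAlgebra.
Variables (k : fieldType) (V : lmodType k).
Implicit Types U W : lmodType k.
Local Notation T := (talg V).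

Lemma lin_word_cat U (h : U -> V) s t :
  lin h -> lin (fun x => word (s ++ h x :: t)).
Proof. by move=> hl; apply: (lin_comp (word_multilin s t) hl). Qed.

Lemma lin_word_head U (h : U -> V) t : lin h -> lin (fun x => word (h x :: t)).
Proof. exact: (lin_word_cat [::]). Qed.

Lemma lin_tlift U (f : seq V -> U) : multilin f -> lin (tlift f).
Proof. exact: peval_linear. Qed.

Lemma lin_tlift_fun U W (f : U -> seq V -> W) (y : T) :
  (forall s, lin (fun x => f x s)) -> lin (fun x => tlift (f x) y).
Proof.
move=> fl c u v; rewrite /tlift /peval /fsum scaler_sumr -big_split /=.
by apply: eq_bigr => p _; rewrite fl scalerDr !scalerA mulrC.
Qed.

Lemma tlift_word U (f : seq V -> U) s : multilin f -> tlift f (word s) = f s.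
Proof. exact: (peval_pgen (good := fun U f => multilin f)). Qed.

Lemma talg_sum (x : T) : exists s : seq (k * seq V), x = \sum_(p <- s) p.1 *: word p.2.
Proof.
exists (repr x); rewrite -[LHS]reprK.
exact: (pclass_fsum (fun U f => multilin f)).
Qed.

Lemma talg_ext U (f g : T -> U) :
  lin f -> lin g -> (forall s, f (word s) = g (word s)) -> f =1 g.
Proof.
move=> fl gl e x; have [s ->] := talg_sum x.
by rewrite !lin_sum //; apply: eq_bigr => p _; rewrite !linZ // e.
Qed.

End TensorAlgebra.

Ltac lin_word ::=
  match goal with
  | |- lin (fun x => word (@?h x :: ?t)) => apply: (lin_word_head t (h := h))
  | |- lin (fun x => word (?s ++ @?h x :: ?t)) => apply: (lin_word_cat s t (h := h))
  end.

Section TensorAlgebraProduct.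
Variables (k : fieldType) (V : lmodType k).
Implicit Types U W : lmodType k.
Local Notation T := (talg V).

Fact tmul_multilin (s : seq V) : multilin (fun t => word (s ++ t)).
Proof. by move=> a b c v w; rewrite !catA; apply: word_multilin. Qed.

Lemma tmul_bilin : bilin (@tmul k V).
Proof.
split=> x.
  apply: lin_tlift => s t; apply: lin_tlift_fun => r c v w.
  by rewrite -!catA; apply: word_multilin.
apply: lin_tlift_fun => s; apply: lin_tlift; exact: tmul_multilin.
Qed.
Hint Resolve tmul_bilin : lin.

Lemma tmul_word (s t : seq V) : tmul (word s) (word t) = word (s ++ t).
Proof.
rewrite /tmul tlift_word ?tlift_word //; first exact: tmul_multilin.
move=> a b; apply: lin_tlift_fun => r c v w.
by rewrite -!catA; apply: word_multilin.
Qed.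

Lemma word_cons v (s : seq V) : word (v :: s) = tmul (word [:: v]) (word s).
Proof. by rewrite tmul_word. Qed.

Lemma lin_word_cons U (s : U -> seq V) v :
  lin (fun x => word (s x)) -> lin (fun x => word (v :: s x)).
Proof.
move=> sl c x y; rewrite word_cons sl (linD (f := tmul _)) ?(linZ (f := tmul _)).
- by rewrite -!word_cons.
- by lin.
- by lin.
Qed.

Lemma tmul1l (x : T) : tmul (word [::]) x = x.
Proof.
apply: (talg_ext (f := tmul _) (g := id)) => [||s]; [by lin|exact: lin_id|].
by rewrite tmul_word.
Qed.

Lemma tmul1r (x : T) : tmul x (word [::]) = x.
Proof.
apply: (talg_ext (f := fun x => tmul x _) (g := id)) => [||s]; [by lin|exact: lin_id|].
by rewrite tmul_word cats0.
Qed.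

Lemma tmulA (x y z : T) : tmul x (tmul y z) = tmul (tmul x y) z.
Proof.
apply: (talg_ext (f := fun x => tmul x (tmul y z))
  (g := fun x => tmul (tmul x y) z)) => [||s]; [by lin|by lin|].
apply: (talg_ext (f := fun y => tmul _ (tmul y z))
  (g := fun y => tmul (tmul _ y) z)) => [||t]; [by lin|by lin|].
apply: (talg_ext (f := fun z => tmul _ (tmul _ z))) => [||r]; [by lin|by lin|].
by rewrite !tmul_word catA.
Qed.

End TensorAlgebraProduct.

#[export] Hint Resolve tmul_bilin : lin.

Ltac lin_word ::=
  match goal with
  | |- lin (fun x => word (@?h x :: ?t)) => apply: (lin_word_head t (h := h))
  | |- lin (fun x => word (?s ++ @?h x :: ?t)) => apply: (lin_word_cat s t (h := h))
  | |- lin (fun x => word (?v :: @?s x)) => apply: (lin_word_cons v (s := s))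
  end.

Arguments tbraid : simpl never.

Section TensorAlgebraOperators.
Variables (k : fieldType) (V : lmodType k).
Implicit Types U W : lmodType k.
Local Notation T := (talg V).

(** Projection onto a sum of homogeneous components: [pred1 n] selects degree [n], and [leq n] is
    the truncation in [braided_factE]. *)
Definition tfilter (P : pred nat) (x : T) : T :=
  tlift (fun s => if P (size s) then word s else 0) x.

Fact tfilter_multilin P :
  multilin (fun s : seq V => if P (size s) then word s else 0).
Proof.
move=> s t c v w; rewrite !size_cat /=; case: (P _); first exact: word_multilin.
by rewrite scaler0 addr0.
Qed.

Lemma lin_tfilter P : lin (tfilter P).
Proof. exact/lin_tlift/tfilter_multilin. Qed.
Hint Resolve lin_tfilter : lin.

Lemma tfilter_word P s : tfilter P (word s) = if P (size s) then word s else 0.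
Proof. exact/tlift_word/tfilter_multilin. Qed.

Lemma tfilter_cons P v (x : T) :
  tfilter P (tmul (word [:: v]) x) = tmul (word [:: v]) (tfilter (fun n => P n.+1) x).
Proof.
apply: (talg_ext (f := fun x => tfilter P (tmul _ x))
  (g := fun x => tmul _ (tfilter _ x))) => [||s]; [by lin|by lin|].
rewrite tmul_word !tfilter_word /=; case: (P _); first by rewrite tmul_word.
by rewrite (lin0 (f := tmul _)) //; lin.
Qed.

(** Homogeneity becomes a linear equation, which is inherited through every operator that commutes
    with [tfilter]. *)
Lemma thomogP n (x : T) : thomog n x <-> tfilter (pred1 n) x = x.
Proof.
split=> [[s sn ->]|<-].
  rewrite lin_sum; last exact: lin_tfilter.
  apply: eq_big_seq => p /(allP sn) pn.
  by rewrite linZ ?tfilter_word //= ?pn //; apply: lin_tfilter.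
have [s ->] := talg_sum x.
exists [seq p <- s | size p.2 == n]; first exact: filter_all.
rewrite lin_sum; last exact: lin_tfilter.
rewrite big_filter [RHS]big_mkcond; apply: eq_bigr => p _.
rewrite linZ; last exact: lin_tfilter.
by rewrite tfilter_word /=; case: ifP; rewrite ?scaler0.
Qed.

Lemma lin_eq0_thomog U (f : T -> U) n x :
  thomog n x -> lin f -> (forall s, size s = n -> f (word s) = 0) -> f x = 0.
Proof.
move=> [s sn ->] fl f0; rewrite lin_sum // big_seq big1 // => p /(allP sn)/eqP pn.
by rewrite linZ // f0 // scaler0.
Qed.

Section Shift.
Variable F : T -> T.
Hypothesis Fl : lin F.

Fact tshift_multilin :
  multilin (fun s => if s is v :: s' then tmul (word [:: v]) (F (word s')) else 0).
Proof. by move=> [|a s] t /=; lin. Qed.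

Lemma lin_tshift : lin (tshift F).
Proof. exact/lin_tlift/tshift_multilin. Qed.
Hint Resolve lin_tshift : lin.

Lemma tshift_nil : tshift F (word [::]) = 0.
Proof. exact/tlift_word/tshift_multilin. Qed.

Lemma tshift_cons v x : tshift F (tmul (word [:: v]) x) = tmul (word [:: v]) (F x).
Proof.
apply: (talg_ext (f := fun x => tshift F (tmul _ x))
  (g := fun x => tmul _ (F x))) => [||s]; [by lin|by lin|].
by rewrite tmul_word /= [LHS]tlift_word //; apply: tshift_multilin.
Qed.

End Shift.

Variable B : V ⊠ V -> V ⊠ V.
Hypothesis Bl : lin B.

Fact tbraid0_multilin :
  multilin (fun s : seq V => if s is v :: w :: s'
                  then \swd_(x, y <- B (v ⊗ w)) word (x :: y :: s') else 0).
Proof.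
move=> [|a [|b s]] t; rewrite /=; [|by lin|by lin].
by case: t => [|w t]; lin.
Qed.

Lemma lin_tbraid i : lin (tbraid B i).
Proof.
elim: i => [|i IHi]; first exact/lin_tlift/tbraid0_multilin.
exact: lin_tshift.
Qed.
Hint Resolve lin_tbraid : lin.

Lemma tbraid_nil i : tbraid B i (word [::]) = 0.
Proof.
case: i => [|i]; last exact/tshift_nil/lin_tbraid.
exact/tlift_word/tbraid0_multilin.
Qed.

Lemma tbraid0_letter v : tbraid B 0 (word [:: v]) = 0.
Proof. exact/tlift_word/tbraid0_multilin. Qed.

Lemma tbraid0_word v w s :
  tbraid B 0 (word (v :: w :: s)) = \swd_(x, y <- B (v ⊗ w)) word (x :: y :: s).
Proof. exact/tlift_word/tbraid0_multilin. Qed.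

Lemma tbraid0_cons v w z :
  tbraid B 0 (tmul (word [:: v; w]) z) =
  \swd_(x, y <- B (v ⊗ w)) tmul (word [:: x; y]) z.
Proof.
apply: (talg_ext (f := fun z => tbraid B 0 (tmul _ z))
  (g := fun z => \swd_(x, y <- B (v ⊗ w)) tmul (word [:: x; y]) z))
  => [||s]; [by lin|by lin|].
by rewrite tmul_word [_ ++ _]/= tbraid0_word; apply: eq_swd => x y; rewrite tmul_word.
Qed.

Lemma tbraidS_cons i v x :
  tbraid B i.+1 (tmul (word [:: v]) x) = tmul (word [:: v]) (tbraid B i x).
Proof. exact/tshift_cons/lin_tbraid. Qed.

Lemma tbraid_tfilter P i x : tfilter P (tbraid B i x) = tbraid B i (tfilter P x).
Proof.
have l1 : lin (fun x => tfilter P (tbraid B i x)) by lin.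
have l2 : lin (fun x => tbraid B i (tfilter P x)) by lin.
apply: (talg_ext l1 l2) => s {l1 l2}.
elim: i P s => [|i IHi] P s; rewrite tfilter_word.
  case: s => [|v [|w s]].
  - by rewrite !tbraid_nil (lin0 (lin_tfilter _)); case: ifP; rewrite ?tbraid_nil ?(lin0 (lin_tbraid _)).
  - by rewrite tbraid0_letter (lin0 (lin_tfilter _)); case: ifP; rewrite ?tbraid0_letter ?(lin0 (lin_tbraid _)).
  rewrite tbraid0_word (lin_swd _ _ (lin_tfilter P)).
  under eq_swd do rewrite tfilter_word /=.
  rewrite -[size (v :: _)]/(size s).+2; case: ifP => _; first by rewrite tbraid0_word.
  by rewrite swd0 (lin0 (lin_tbraid _)).
case: s => [|v s].
  by rewrite tbraid_nil (lin0 (lin_tfilter _)); case: ifP; rewrite ?tbraid_nil ?(lin0 (lin_tbraid _)).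
rewrite word_cons tbraidS_cons tfilter_cons IHi tfilter_word /=.
case: ifP => _; first by rewrite tbraidS_cons.
by rewrite !(lin0 (lin_tbraid _)) (lin0 (f := tmul _)) //; lin.
Qed.

(** The length condition keeps both places on which [tbraid B i] acts inside [s]; on a shorter [s]
    the right side is 0, while the left side may reach into [y]. *)
Lemma tbraid_mulr i s y :
  (i.+1 < size s)%N -> tbraid B i (tmul (word s) y) = tmul (tbraid B i (word s)) y.
Proof.
elim: i s => [|i IHi] [|v s] //.
  case: s => [|w s] // _.
  rewrite -[v :: w :: s]/([:: v; w] ++ s) -tmul_word -tmulA !tbraid0_cons.
  rewrite (lin_swd _ _ (g := fun x => tmul x y)); last by lin.
  by apply: eq_swd => x z; rewrite tmulA.
by move=> si; rewrite word_cons -tmulA !tbraidS_cons IHi // tmulA.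
Qed.

Lemma tbraid_far i j x :
  (i.+1 < j)%N -> tbraid B i (tbraid B j x) = tbraid B j (tbraid B i x).
Proof.
move=> ij; have l1 : lin (fun x => tbraid B i (tbraid B j x)) by lin.
have l2 : lin (fun x => tbraid B j (tbraid B i x)) by lin.
apply: (talg_ext l1 l2) => s {l1 l2}.
elim: i j ij s => [|i IHi] [|j] // ij [|v s]; rewrite ?tbraid_nil ?(lin0 (lin_tbraid _)) ?tbraid_nil //.
  case: j ij => // j _; case: s => [|w s].
    by rewrite tbraid0_letter word_cons tbraidS_cons tbraid_nil
      (lin0 (f := tmul _)) ?(lin0 (lin_tbraid _)) //; lin.
  rewrite word_cons [word (w :: s)]word_cons !tbraidS_cons !tmulA !(tmul_word [:: v]) !tbraid0_cons.
  rewrite (lin_swd _ _ (lin_tbraid _)); apply: eq_swd => y z.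
  by rewrite -[[:: y; z]]/([:: y] ++ [:: z]) -tmul_word -!tmulA !tbraidS_cons.
by rewrite word_cons !tbraidS_cons IHi.
Qed.

(** Higher indices reduce to index 0 by removing letters. On words of fewer than three letters both
    sides vanish, because [tbraid B 1] kills words of length two and all operators kill shorter
    ones. *)
Lemma tbraid_braid :
  (forall u v w s (b := tbraid B),
     b 0 (b 1 (b 0 (word (u :: v :: w :: s)))) =
     b 1 (b 0 (b 1 (word (u :: v :: w :: s))))) ->
  forall i x (b := tbraid B), b i (b i.+1 (b i x)) = b i.+1 (b i (b i.+1 x)).
Proof.
move=> yb i x b.
have l1 : lin (fun x => b i (b i.+1 (b i x))) by rewrite /b; lin.
have l2 : lin (fun x => b i.+1 (b i (b i.+1 x))) by rewrite /b; lin.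
apply: (talg_ext l1 l2) => s {l1 l2}; rewrite {}/b.
elim: i s => [|i IHi] [|v s]; rewrite ?tbraid_nil ?(lin0 (lin_tbraid _)) //.
  case: s => [|w [|u s]].
  - rewrite tbraid0_letter word_cons tbraidS_cons tbraid_nil.
    by rewrite (lin0 (f := tmul _)) ?(lin0 (lin_tbraid _)) //; lin.
  - have b1 a c : tbraid B 1 (word [:: a; c]) = 0.
      rewrite word_cons tbraidS_cons tbraid0_letter.
      by rewrite (lin0 (f := tmul _)) //; lin.
    rewrite b1 tbraid0_word !(lin_swd _ _ (lin_tbraid _)) (lin0 (lin_tbraid _)).
    rewrite (lin0 (lin_tbraid _)) -[RHS](swd0 _ (B (v ⊗ w))).
    by apply: eq_swd => a c; rewrite b1 (lin0 (lin_tbraid _)).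
  - exact: yb.
by rewrite word_cons !tbraidS_cons IHi.
Qed.

Let bD i : {morph tbraid B i : x y / x + y} := linD (lin_tbraid i).

Lemma lin_bint j n : lin (bint (tbraid B) j n).
Proof. by elim: n j => [|n IHn] j /=; lin. Qed.

Lemma lin_bfact j n : lin (bfact (tbraid B) j n).
Proof.
elim: n j => [|n IHn] j; first exact: lin_id.
exact: lin_comp (IHn _) (lin_bint _ _).
Qed.
Hint Resolve lin_bint lin_bfact : lin.

Lemma braided_intE n x : braided_int B n x = bint (tbraid B) 0 n x.
Proof. by rewrite bint_foldr. Qed.

(* [tshift] kills the empty word, hence the truncation. *)
Lemma braided_factE n x :
  braided_fact B n x = tfilter (leq n) (bfact (tbraid B) 0 n x).
Proof.
elim: n x => [|n IHn] x.
  apply: (talg_ext (f := id)) => [||s]; [exact: lin_id|exact: lin_tfilter|].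
  by rewrite tfilter_word.
have Fl : lin (braided_fact B n).
  move=> c u v; rewrite !IHn.
  by apply: (_ : lin (fun x => tfilter _ (bfact (tbraid B) 0 n x))); lin.
rewrite -[LHS]/(tshift (braided_fact B n) (braided_int B n.+1 x)) braided_intE.
rewrite -[bfact _ _ _ x]/(bfact (tbraid B) 1 n (bint (tbraid B) 0 n.+1 x)).
have l1 := lin_tshift Fl.
have l2 : lin (fun x => tfilter (leq n.+1) (bfact (tbraid B) 1 n x)) by lin.
apply: (talg_ext l1 l2) => -[|v s] {l1 l2}.
  rewrite tshift_nil //.
  (* All operators kill the empty word, so the abstract factorial fixes it; the filter is what
     removes it. *)
  have nilE j m : bfact (tbraid B) j m (word [::]) = word [::].
    elim: m j => [//|m IHm] j.
    rewrite -[LHS]/(bfact (tbraid B) _ m (bint (tbraid B) _ m.+1 _)).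
    suff -> : bint (tbraid B) j m.+1 (word [::]) = word [::] by [].
    elim: m {IHm} j => [|m IHm] j; first by rewrite /= (lin0 (lin_tbraid _)) addr0.
    rewrite -[LHS]/(word [::] + tbraid B _ (bint (tbraid B) _ m.+1 _)).
    by rewrite IHm tbraid_nil addr0.
  by rewrite nilE tfilter_word.
rewrite word_cons tshift_cons // IHn.
(* Here id ⊗ [n, B]! is identified with the factorial shifted by one place. *)
have := @bfact_morph _ (tbraid B) bD (tmul (word [:: v])) 0 n (fun _ => True) _ _ _ _ 1.
move=> <- //; last by move=> i y _ _ _; rewrite tbraidS_cons.
  by rewrite tfilter_cons.
by apply: linD; lin.
Qed.

Lemma tfilter_bfact P j n x :
  tfilter P (bfact (tbraid B) j n x) = bfact (tbraid B) j n (tfilter P x).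
Proof.
apply: (bfact_morph bD (S := fun _ => True) _ _ _ _ (s := 0)) => //.
  exact: linD (lin_tfilter P).
by move=> i y _ _ _; apply: tbraid_tfilter.
Qed.

(** The operators preserve length, so on degree [n] the truncation [leq n] removes nothing. *)
Lemma braided_fact_homog n x : thomog n x ->
  braided_fact B n x = bfact (tbraid B) 0 n x.
Proof.
move=> /thomogP hx; rewrite braided_factE tfilter_bfact -{1}hx; congr bfact.
rewrite -{2}hx; apply: (talg_ext (f := fun x => tfilter _ (tfilter _ x)))
  => [||s]; [by lin|by lin|].
by rewrite tfilter_word /=; case: eqP => [<-|_];
  rewrite ?(lin0 (lin_tfilter _)) ?tfilter_word ?leqnn.
Qed.

Lemma braided_fact_ker_consl n x v : thomog n x -> braided_fact B n x = 0 ->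
  braided_fact B n.+1 (tmul (word [:: v]) x) = 0.
Proof.
move=> hx; rewrite braided_fact_homog // => x0.
rewrite braided_factE bfactSl //; last exact: tbraid_far.
have := @bfact_morph _ (tbraid B) bD (tmul (word [:: v])) 0 n (fun _ => True) _ _ _ _ 1.
move=> <- //; last by move=> i y _ _ _; rewrite tbraidS_cons.
  rewrite x0 (lin0 (f := tmul _)) ?bintr0 ?(lin0 (lin_tfilter _)) //; lin.
by apply: linD; lin.
Qed.

Hypothesis Bbraid : forall u v w s (b := tbraid B),
  b 0 (b 1 (b 0 (word (u :: v :: w :: s)))) =
  b 1 (b 0 (b 1 (word (u :: v :: w :: s)))).

Lemma braided_fact_ker_consr n x v : thomog n x -> braided_fact B n x = 0 ->
  braided_fact B n.+1 (tmul x (word [:: v])) = 0.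
Proof.
move=> hx; rewrite braided_fact_homog // => x0.
rewrite braided_factE bfactSr //; [|exact: tbraid_far|exact: tbraid_braid].
(* In degree [n] the operators occurring in the factorial act inside the first [n] letters, hence do
   not meet the letter appended on the right. *)
pose S (y : T) := tfilter (pred1 n) y = y.
have := @bfact_morph _ (tbraid B) bD (fun y => tmul y (word [:: v])) 0 n S _ _ _ _ 0.
move=> <- //.
- by rewrite x0 (lin0 (f := fun y => tmul y _)) ?bcosets0 ?(lin0 (lin_tfilter _)) //; lin.
- by apply: linD; lin.
- by move=> y z yS zS; rewrite /S (linD (lin_tfilter _)) yS zS.
- exact: lin0 (lin_tfilter _).
- by move=> i y _ _ yS; rewrite /S tbraid_tfilter yS.
- move=> i y _ ijn <-; apply: esym.
  apply: (talg_ext (f := fun y => tbraid B i (tmul (tfilter _ y) _))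
    (g := fun y => tmul (tbraid B i (tfilter _ y)) _)) => [||s]; [by lin|by lin|].
  rewrite tfilter_word /=; case: eqP => [sn|_]; first by rewrite tbraid_mulr // sn.
  by rewrite ?(lin0 (f := fun y => tmul y _)) ?(lin0 (lin_tbraid _))
    ?(lin0 (f := fun y => tmul y _)) //; lin.
- exact/thomogP.
Qed.

End TensorAlgebraOperators.

#[export] Hint Resolve lin_tfilter lin_tshift lin_tbraid : lin.

(** * Crossed modules *)

Section SweedlerAssoc.
Variable k : fieldType.

Definition trilin (V1 V2 V3 U : lmodType k) (F : V1 -> V2 -> V3 -> U) : Prop :=
  [/\ forall y z, lin (fun x => F x y z), forall x z, lin (fun y => F x y z) &
      forall x y, lin (fun z => F x y z)].

(** The premise is an identity in the triple tensor product, and [L] is the linear map that [F]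
    induces there. This covers coassociativity of the coproduct and of a coaction alike. *)
Lemma swd_assoc (V1 V2 V3 P Q U : lmodType k) (t : P ⊠ V3) (f : P -> V1 ⊠ V2)
    (t' : V1 ⊠ Q) (g : Q -> V2 ⊠ V3) (F : V1 -> V2 -> V3 -> U) :
  \swd_(p, z <- t) \swd_(x, y <- f p) (x ⊗ (y ⊗ z)) = \swd_(x, q <- t') (x ⊗ g q) ->
  trilin F ->
  \swd_(p, z <- t) \swd_(x, y <- f p) F x y z =
  \swd_(x, q <- t') \swd_(y, z <- g q) F x y z.
Proof.
move=> e [F1 F2 F3].
have F23 x : bilin (F x) by split=> y; [apply: F2|apply: F3].
have b2 : bilin (fun x u => \swd_(y, z <- u) F x y z) by lin.
pose L t := \swd_(x, u <- t) \swd_(y, z <- u) F x y z.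
have Ll : lin L by rewrite /L; lin.
have LE x u : L (x ⊗ u) = \swd_(y, z <- u) F x y z by rewrite /L swd_tens.
transitivity (L (\swd_(x, q <- t') (x ⊗ g q))).
  rewrite -e (lin_swd _ _ Ll); apply: eq_swd => p z.
  by rewrite (lin_swd _ _ Ll); apply: eq_swd => x y; rewrite LE swd_tens.
by rewrite (lin_swd _ _ Ll); apply: eq_swd => x q; rewrite LE.
Qed.

End SweedlerAssoc.

Ltac trilin := split; lin.

Section HopfAlgebra.
Variables (k : fieldType) (A : hopfType k).
Implicit Types U : lmodType k.

Lemma lin_comul : lin (comul : A -> A ⊠ A). Proof. exact: linearP. Qed.
Lemma lin_antipode : lin (antipode : A -> A). Proof. exact: linearP. Qed.
Lemma lin_counit : lin (counit : A -> k^o). Proof. exact: linearP. Qed.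

Lemma mul_bilin : bilin (@GRing.mul A).
Proof. by split=> x c a b; rewrite ?mulrDl ?mulrDr -?scalerAl -?scalerAr. Qed.

Lemma lin_comul_comp U (h : U -> A) : lin h -> lin (fun x => comul (h x)).
Proof. exact: lin_comp lin_comul. Qed.

Lemma lin_antipode_comp U (h : U -> A) : lin h -> lin (fun x => antipode (h x)).
Proof. exact: lin_comp lin_antipode. Qed.

Lemma lin_counit_comp U (h : U -> A) : lin h -> lin (fun x => counit (h x) : k^o).
Proof. exact: lin_comp lin_counit. Qed.

Lemma lin_mulr (a : A) : lin (fun x : A => a * x).
Proof. exact: mul_bilin.2. Qed.

Lemma lin_mull (a : A) : lin (fun x : A => x * a).
Proof. exact: mul_bilin.1. Qed.

End HopfAlgebra.

#[export] Hint Extern 0 (lin (fun x => GRing.mul x _)) => exact: lin_mull : lin.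
#[export] Hint Extern 0 (lin (GRing.mul _)) => exact: lin_mulr : lin.
#[export] Hint Resolve lin_comul lin_antipode lin_counit mul_bilin : lin.
#[export] Hint Extern 1 (lin (fun x => GRing.Linear.sort _ x)) =>
  first [exact: lin_comul | exact: lin_antipode | exact: lin_counit] : lin.

Ltac lin_hopf :=
  match goal with
  | |- @lin _ ?U _ (fun x => GRing.Linear.sort (@counit ?k ?A) (@?h x)) =>
      refine (@lin_counit_comp k A U h _)
  | |- @lin _ ?U _ (fun x => GRing.Linear.sort (@comul ?k ?A) (@?h x)) =>
      refine (@lin_comul_comp k A U h _)
  | |- @lin _ ?U _ (fun x => GRing.Linear.sort (@antipode ?k ?A) (@?h x)) =>
      refine (@lin_antipode_comp k A U h _)
  end.

Ltac lin_word ::=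
  match goal with
  | |- lin (fun x => word (@?h x :: ?t)) => apply: (lin_word_head t (h := h))
  | |- lin (fun x => word (?s ++ @?h x :: ?t)) => apply: (lin_word_cat s t (h := h))
  | |- lin (fun x => word (?v :: @?s x)) => apply: (lin_word_cons v (s := s))
  | |- _ => lin_hopf
  end.

Section HopfAlgebraSweedler.
Variables (k : fieldType) (A : hopfType k).
Implicit Types U : lmodType k.

Lemma swd_comulA U (F : A -> A -> A -> U) a : trilin F ->
  \swd_(x, y <- comul a) \swd_(x1, x2 <- comul x) F x1 x2 y =
  \swd_(x, y <- comul a) \swd_(y1, y2 <- comul y) F x y1 y2.
Proof. by move=> Ft; apply: (swd_assoc _ Ft); apply: comulA. Qed.

Lemma swd_counitl U (f : A -> U) a : lin f ->
  \swd_(x, y <- comul a) (counit x *: f y) = f a.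
Proof.
move=> fl; rewrite -[in RHS](counitl a) (lin_swd _ _ fl).
by apply: eq_swd => x y; rewrite linZ.
Qed.

Lemma swd_counitr U (f : A -> U) a : lin f ->
  \swd_(x, y <- comul a) (counit y *: f x) = f a.
Proof.
move=> fl; rewrite -[in RHS](counitr a) (lin_swd _ _ fl).
by apply: eq_swd => x y; rewrite linZ.
Qed.

End HopfAlgebraSweedler.

Section CrossedModule.
Variables (k : fieldType) (A : hopfType k) (V : lmodType k).
Variable X : crossed_ops A V.
Hypothesis XP : is_crossed X.
Implicit Types U : lmodType k.
Local Notation T := (talg V).

Lemma ract_bilin : bilin (ract X). Proof. by case: XP => -[]. Qed.
Lemma lin_rcoact : lin (rcoact X). Proof. by case: XP => _ []. Qed.
Hint Resolve ract_bilin lin_rcoact : lin.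

Lemma ract1 v : ract X v 1 = v. Proof. by case: XP => -[]. Qed.

Lemma ractM v a c : ract X (ract X v a) c = ract X v (a * c).
Proof. by case: XP => -[]. Qed.

Lemma swd_rcoact_counit U (f : V -> U) v : lin f ->
  \swd_(v0, v1 <- rcoact X v) (counit v1 *: f v0) = f v.
Proof.
move=> fl; case: XP => _ [_ e _] _; rewrite -[in RHS](e v) (lin_swd _ _ fl).
by apply: eq_swd => x y; rewrite linZ.
Qed.

Lemma swd_rcoactA U (F : V -> A -> A -> U) v : trilin F ->
  \swd_(v0, v1 <- rcoact X v) \swd_(v00, v01 <- rcoact X v0) F v00 v01 v1 =
  \swd_(v0, v1 <- rcoact X v) \swd_(a1, a2 <- comul v1) F v0 a1 a2.
Proof. by move=> Ft; apply: (swd_assoc _ Ft); case: XP => _ []. Qed.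

Lemma rcoact_ract v a : rcoact X (ract X v a) =
  \swd_(v0, v1 <- rcoact X v) \swd_(a1, a23 <- comul a) \swd_(a2, a3 <- comul a23)
    ract X v0 a2 ⊗ (antipode a1 * v1 * a3).
Proof. by case: XP. Qed.

Lemma lin_Psi : lin (Psi X).
Proof. by rewrite /Psi; lin. Qed.
Hint Resolve lin_Psi : lin.

Lemma Psi_tens v w :
  Psi X (v ⊗ w) = \swd_(w0, w1 <- rcoact X w) w0 ⊗ ract X v w1.
Proof. by rewrite /Psi swd_tens //; lin. Qed.

Lemma lin_negPsi : lin (negPsi X).
Proof. by rewrite /negPsi; lin. Qed.
Hint Resolve lin_negPsi : lin.

(* By coassociativity of the coaction, the braid relation for [Psi] is an instance
   of its [A]-linearity. *)
Lemma Psi_ract v w a :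
  \swd_(a1, a2 <- comul a) Psi X (ract X v a1 ⊗ ract X w a2) =
  \swd_(x, y <- Psi X (v ⊗ w)) \swd_(a1, a2 <- comul a) (ract X x a1 ⊗ ract X y a2).
Proof.
rewrite Psi_tens swd_swd; last by lin.
transitivity (\swd_(a1, a2 <- comul a) \swd_(w0, w1 <- rcoact X w)
  \swd_(b1, b23 <- comul a2) \swd_(b2, b3 <- comul b23)
    (ract X w0 b2 ⊗ ract X v (a1 * (antipode b1 * w1 * b3)))).
  apply: eq_swd => a1 a2; rewrite Psi_tens rcoact_ract swd_swd; last by lin.
  apply: eq_swd => w0 w1; rewrite swd_swd; last by lin.
  apply: eq_swd => b1 b23; rewrite swd_swd; last by lin.
  by apply: eq_swd => b2 b3; rewrite swd_tens ?ractM //; lin.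
rewrite exchange_swd; apply: eq_swd => w0 w1.
rewrite -(swd_comulA (F := fun a1 b1 b23 => \swd_(b2, b3 <- comul b23)
    (ract X w0 b2 ⊗ ract X v (a1 * (antipode b1 * w1 * b3))))); last by trilin.
(* Coassociativity has brought the product of a leg and the antipode of the next one together; it
   collapses to the counit. *)
transitivity (\swd_(x, y <- comul a) (counit x *: \swd_(b2, b3 <- comul y)
    (ract X w0 b2 ⊗ ract X v (w1 * b3)))).
  apply: eq_swd => x y.
  pose L (z : A) := \swd_(b2, b3 <- comul y) (ract X w0 b2 ⊗ ract X v (z * (w1 * b3))).
  have Ll : lin L by rewrite /L; lin.
  transitivity (L (\swd_(x1, x2 <- comul x) (x1 * antipode x2))).
    rewrite (lin_swd _ _ Ll); apply: eq_swd => x1 x2.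
    by rewrite /L; apply: eq_swd => b2 b3; rewrite !mulrA.
  rewrite antipoder linZ // /L; congr (_ *: _); apply: eq_swd => b2 b3.
  by rewrite mul1r.
rewrite swd_counitl; last by lin.
by rewrite swd_tens; [apply: eq_swd => b2 b3; rewrite ractM|lin].
Qed.

Local Notation b := (tbraid (negPsi X)).

Lemma tbraid_negPsi0 v w s :
  b 0 (word (v :: w :: s)) = - \swd_(w0, w1 <- rcoact X w) word (w0 :: ract X v w1 :: s).
Proof.
rewrite (tbraid0_word lin_negPsi) /negPsi (linN (f := fun t => sweedler t _)); last by lin.
congr (- _); rewrite Psi_tens swd_swd; last by lin.
by apply: eq_swd => w0 w1; rewrite swd_tens //; lin.
Qed.

Lemma tbraid_negPsi1 u v w s : b 1 (word (u :: v :: w :: s)) =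
  - \swd_(w0, w1 <- rcoact X w) word (u :: w0 :: ract X v w1 :: s).
Proof.
rewrite word_cons (tbraidS_cons lin_negPsi) tbraid_negPsi0 (linN (f := tmul _)); last by lin.
congr (- _); rewrite (lin_swd _ _ (g := tmul _)); last by lin.
by apply: eq_swd => w0 w1; rewrite -word_cons.
Qed.

(** On both sides [w0] moves to the front and [w1] acts diagonally on the other two letters. The
    sides differ only in whether [Psi] is applied to [u ⊗ v] before or after this action, so
    [Psi_ract] identifies them. *)
Lemma tbraid_negPsi_braid u v w s :
  b 0 (b 1 (b 0 (word (u :: v :: w :: s)))) =
  b 1 (b 0 (b 1 (word (u :: v :: w :: s)))).
Proof.
have bl i : lin (b i) by lin.
have -> : b 0 (b 1 (b 0 (word (u :: v :: w :: s)))) =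
    - \swd_(v0, v1 <- rcoact X v) \swd_(w0, w1 <- rcoact X w)
      \swd_(w00, w01 <- rcoact X w0)
        word (w00 :: ract X v0 w01 :: ract X (ract X u v1) w1 :: s).
  rewrite tbraid_negPsi0 !(linN _ (bl _)); congr (- _).
  rewrite !(lin_swd _ _ (bl _)); apply: eq_swd => v0 v1.
  rewrite tbraid_negPsi1 (linN _ (bl _)) (lin_swd _ _ (bl _)) -swdN.
  by apply: eq_swd => w0 w1; rewrite tbraid_negPsi0 opprK.
have -> : b 1 (b 0 (b 1 (word (u :: v :: w :: s)))) =
    - \swd_(w0, w1 <- rcoact X w) \swd_(w00, w01 <- rcoact X w0)
      \swd_(x, y <- Psi X (ract X u w01 ⊗ ract X v w1)) word (w00 :: x :: y :: s).
  rewrite tbraid_negPsi1 !(linN _ (bl _)); congr (- _).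
  rewrite !(lin_swd _ _ (bl _)); apply: eq_swd => w0 w1.
  rewrite tbraid_negPsi0 (linN _ (bl _)) (lin_swd _ _ (bl _)) -swdN.
  apply: eq_swd => w00 w01; rewrite tbraid_negPsi1 opprK Psi_tens swd_swd; last by lin.
  by apply: eq_swd => x y; rewrite swd_tens //; lin.
congr (- _); rewrite exchange_swd.
transitivity (\swd_(w0, w1 <- rcoact X w) \swd_(a1, a2 <- comul w1)
    \swd_(x, y <- Psi X (ract X u a1 ⊗ ract X v a2)) word (w0 :: x :: y :: s)).
  transitivity (\swd_(w0, w1 <- rcoact X w) \swd_(w00, w01 <- rcoact X w0)
      \swd_(v0, v1 <- rcoact X v)
        word (w00 :: ract X v0 w01 :: ract X (ract X u v1) w1 :: s)).
    by apply: eq_swd => w0 w1; rewrite exchange_swd.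
  rewrite (swd_rcoactA (F := fun w0 a1 a2 => \swd_(v0, v1 <- rcoact X v)
    word (w0 :: ract X v0 a1 :: ract X (ract X u v1) a2 :: s))); last by trilin.
  apply: eq_swd => w0 w1.
  rewrite -(swd_swd _ _ (g := fun x y => word (w0 :: x :: y :: s))); last by lin.
  rewrite Psi_ract Psi_tens !swd_swd; [|by lin..].
  rewrite exchange_swd; apply: eq_swd => v0 v1.
  rewrite swd_tens ?swd_swd; [|by lin..].
  by apply: eq_swd => a1 a2; rewrite swd_tens //; lin.
rewrite (swd_rcoactA (F := fun w0 a1 a2 => \swd_(x, y <- Psi X (ract X u a1 ⊗ ract X v a2))
  word (w0 :: x :: y :: s))) //.
by trilin.
Qed.

End CrossedModule.

#[export] Hint Resolve ract_bilin lin_rcoact lin_Psi lin_negPsi : lin.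

(** * The braided exterior algebra *)

Section TensorAction.
Variables (k : fieldType) (A : hopfType k) (V : lmodType k).
Variable X : crossed_ops A V.
Hypothesis XP : is_crossed X.
Implicit Types U : lmodType k.
Local Notation T := (talg V).
Local Notation b := (tbraid (negPsi X)).

Lemma lin_wact s : lin (wact X s).
Proof. by elim: s => [|v s IHs] /=; lin. Qed.

Fact wact_multilin a : multilin ((wact X)^~ a).
Proof.
move=> s t; move: a; elim: s => [|u s IHs] a; rewrite /=.
  by have := lin_wact t; lin.
by apply: lin_sweedler_fun => a1 a2; have := IHs a2; lin.
Qed.

Lemma tact_bilin : bilin (tact X).
Proof.
split=> x; first exact/lin_tlift/wact_multilin.
by apply: lin_tlift_fun => s; apply: lin_wact.
Qed.
Hint Resolve lin_wact tact_bilin : lin.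

Lemma tact_word s a : tact X (word s) a = wact X s a.
Proof. exact/tlift_word/wact_multilin. Qed.

Lemma tact_cons v x a : tact X (tmul (word [:: v]) x) a =
  \swd_(a1, a2 <- comul a) tmul (word [:: ract X v a1]) (tact X x a2).
Proof.
apply: (talg_ext (f := fun x => tact X (tmul _ x) a)
  (g := fun x => \swd_(a1, a2 <- comul a) tmul (word [:: ract X v a1]) (tact X x a2)))
  => [||s]; [by lin|by lin|].
by rewrite tmul_word tact_word; apply: eq_swd => a1 a2; rewrite tact_word.
Qed.

Lemma tact1 x : tact X x 1 = x.
Proof.
apply: (talg_ext (f := fun x => tact X x 1) (g := id)) => [||s]; [by lin|exact: lin_id|].
elim: s => [|v s IHs]; first by rewrite tact_word /= counit1 scale1r.
by rewrite word_cons tact_cons comul1 swd_tens ?ract1 ?IHs //; lin.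
Qed.

Lemma tfilter_tact P x a : tfilter P (tact X x a) = tact X (tfilter P x) a.
Proof.
apply: (talg_ext (f := fun x => tfilter P (tact X x a))
  (g := fun x => tact X (tfilter P x) a)) => [||s]; [by lin|by lin|].
elim: s P a => [|v s IHs] P a.
  rewrite tact_word /= linZ ?tfilter_word; last by lin.
  case: ifP => _; first by rewrite tact_word.
  by rewrite scaler0 (lin0 (f := fun x => tact X x a)) //; lin.
rewrite word_cons tact_cons (lin_swd _ _ (lin_tfilter P)) tfilter_cons tact_cons.
by apply: eq_swd => a1 a2; rewrite tfilter_cons IHs.
Qed.

Lemma tbraid_tact i x a : b i (tact X x a) = tact X (b i x) a.
Proof.
have bl j : lin (b j) by lin.
apply: (talg_ext (f := fun x => b i (tact X x a))
  (g := fun x => tact X (b i x) a)) => [||s {x}]; [by lin|by lin|].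
elim: i s a => [|i IHi] [|v s] a.
- by rewrite tact_word /= linZ // tbraid_nil ?scaler0 ?(lin0 (f := fun x => tact X x a)) //; lin.
- case: s => [|w s].
    rewrite word_cons tact_cons (lin_swd _ _ (bl _)) tmul1r tbraid0_letter; last by lin.
    rewrite (lin0 (f := fun x => tact X x a)); last by lin.
    rewrite -[RHS](swd0 _ (comul a)); apply: eq_swd => a1 a2.
    rewrite tact_word [wact _ _ _]/= (linZ (f := tmul _)); last by lin.
    by rewrite tmul1r linZ // tbraid0_letter ?scaler0 //; lin.
  (* [M] separates the two letters on which [b 0] acts from the rest. Bracketing the double
     coproduct of [a] to the left then puts the action on these two letters in the form required by
     [Psi_ract]. *)
  pose M (x y : V) := tmul (word [:: x; y]).
  have Mb z : bilin (fun x y => M x y z) by rewrite /M; lin.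
  have Ml x y : lin (M x y) by rewrite /M; lin.
  have tactM x y z : tact X (M x y z) a =
      \swd_(c, a3 <- comul a) \swd_(a1, a2 <- comul c)
        M (ract X x a1) (ract X y a2) (tact X z a3).
    rewrite /M -[[:: x; y]]/([:: x] ++ [:: y]) -tmul_word -tmulA tact_cons.
    rewrite (swd_comulA (F := fun a1 a2 a3 =>
      tmul (word [:: ract X x a1; ract X y a2]) (tact X z a3))); last by trilin.
    apply: eq_swd => a1 a23; rewrite tact_cons (lin_swd _ _ (g := tmul _)); last by lin.
    by apply: eq_swd => a2 a3; rewrite tmulA tmul_word.
  have b0M x y z : b 0 (M x y z) = - \swd_(x', y' <- Psi X (x ⊗ y)) M x' y' z.
    by rewrite /M tbraid0_cons ?/negPsi ?(linN (f := fun t => sweedler t _)) //; lin.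
  rewrite -[v :: w :: s]/([:: v; w] ++ s) -tmul_word -/(M v w (word s)).
  rewrite tactM b0M (linN (f := fun x => tact X x a)); last by lin.
  rewrite (lin_swd _ _ (bl _)) (lin_swd _ _ (g := fun x => tact X x a)); last by lin.
  under [in RHS]eq_swd do rewrite tactM.
  rewrite [in RHS]exchange_swd -swdN; apply: eq_swd => c a3.
  rewrite (lin_swd _ _ (bl _)).
  transitivity (- \swd_(a1, a2 <- comul c)
    \swd_(x, y <- Psi X (ract X v a1 ⊗ ract X w a2)) M x y (tact X (word s) a3)).
    by rewrite -swdN; apply: eq_swd => a1 a2; rewrite b0M.
  congr (- _).
  rewrite -(swd_swd _ _ (g := fun x y => M x y (tact X (word s) a3))); last by lin.
  rewrite Psi_ract // swd_swd; last by lin.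
  apply: eq_swd => x y; rewrite swd_swd; last by lin.
  by apply: eq_swd => a1 a2; rewrite swd_tens.
- by rewrite tact_word /= linZ // tbraid_nil ?scaler0 ?(lin0 (f := fun x => tact X x a)) //; lin.
- rewrite word_cons tact_cons (lin_swd _ _ (bl _)) tbraidS_cons ?tact_cons; last by lin.
  by apply: eq_swd => a1 a2; rewrite tbraidS_cons ?IHi //; lin.
Qed.

Lemma thomog_tact n x a : thomog n x -> thomog n (tact X x a).
Proof. by move=> /thomogP hx; apply/thomogP; rewrite tfilter_tact hx. Qed.

Lemma bker_tact x a : bker X x -> bker X (tact X x a).
Proof.
move=> [n hx x0]; exists n; first exact: thomog_tact.
have hxa := thomog_tact a hx; have negPsil := lin_negPsi XP; move: x0.
rewrite !braided_fact_homog //.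
have bD i : {morph b i : x y / x + y} by apply: linD; lin.
have := bfact_morph bD (f := fun x => tact X x a) (j := 0) (n := n)
  (S := fun _ => True) _ _ _ _ (s := 0).
move=> <- //; last by move=> i y _ _ _; rewrite tbraid_tact.
  by move=> ->; rewrite (lin0 (f := fun x => tact X x a)) //; lin.
by apply: linD; lin.
Qed.

Lemma thomog_mul m n (x y : T) : thomog m x -> thomog n y -> thomog (m + n) (tmul x y).
Proof.
move=> /thomogP <- /thomogP <-; apply/thomogP.
apply: (talg_ext (f := fun x => tfilter _ (tmul (tfilter _ x) _))
  (g := fun x => tmul (tfilter _ x) _)) => [||s]; [by lin|by lin|].
apply: (talg_ext (f := fun y => tfilter _ (tmul _ (tfilter _ y)))
  (g := fun y => tmul _ (tfilter _ y))) => [||t]; [by lin|by lin|].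
have l0 P := lin0 (lin_tfilter (V := V) P).
rewrite !tfilter_word /=; case: eqP => [<-|_]; last first.
  by rewrite (lin0 (f := fun x => tmul x _)) ?l0 //; lin.
case: eqP => [<-|_]; last by rewrite (lin0 (f := tmul _)) ?l0 //; lin.
by rewrite tmul_word tfilter_word /= size_cat eqxx.
Qed.

Lemma thomog_word (s : seq V) : thomog (size s) (word s).
Proof. by apply/thomogP; rewrite tfilter_word /= eqxx. Qed.

Lemma bker_mull s x : bker X x -> bker X (tmul (word s) x).
Proof.
elim: s => [|v s IHs] xk; first by rewrite tmul1l.
have [n hx x0] := IHs xk; exists n.+1; rewrite word_cons -tmulA.
  exact: (thomog_mul (thomog_word [:: v]) hx).
by apply: braided_fact_ker_consl => //; lin.
Qed.

Lemma bker_mulr s x : bker X x -> bker X (tmul x (word s)).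
Proof.
elim: s x => [|v s IHs] x xk; first by rewrite tmul1r.
rewrite word_cons tmulA; apply: IHs; have [n hx x0] := xk.
exists n.+1; first by rewrite -addn1; apply: (thomog_mul hx (thomog_word [:: v])).
by apply: braided_fact_ker_consr => //; [lin|move=> *; apply: tbraid_negPsi_braid].
Qed.

End TensorAction.

#[export] Hint Resolve lin_wact tact_bilin : lin.

Section BraidedExterior.
Variables (k : fieldType) (A : hopfType k) (V : lmodType k).
Variable X : crossed_ops A V.
Hypothesis XP : is_crossed X.
Implicit Types U : lmodType k.
Local Notation T := (talg V).
Local Notation B := (bext X).

Lemma lin_bcls : lin (bcls X). Proof. exact: bcls_linear. Qed.
Hint Resolve lin_bcls : lin.

Definition bgood U (f : T -> U) : Prop :=
  lin f /\ forall x, bker X x -> f x = 0.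

Lemma lin_blift U (f : T -> U) : bgood f -> lin (blift f : B -> U).
Proof. by move=> fg; apply: peval_linear. Qed.

Lemma blift_bcls U (f : T -> U) t : bgood f -> blift f (bcls X t) = f t.
Proof. exact: (peval_pgen (good := fun U (f : T -> U) => linear f /\ _)). Qed.

(** The value of [blift] is a finite sum over a representative, so [g] passes inside even when [f]
    does not descend to the quotient. This allows a projection to be applied before well-definedness
    is checked. *)
Lemma lin_blift_out U U' (g : U -> U') (f : T -> U) (x : B) :
  lin g -> g (blift f x) = blift (fun t => g (f t)) x.
Proof.
move=> gl; rewrite /blift /peval /fsum lin_sum //.
by apply: eq_bigr => p _; rewrite linZ.
Qed.

Lemma bcls_surj (x : B) : exists t, x = bcls X t.
Proof.
exists (\sum_(p <- repr x) p.1 *: p.2); rewrite -[LHS]reprK.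
rewrite [LHS](pclass_fsum (fun U (f : T -> U) => linear f /\ forall x, bker X x -> f x = 0)).
by rewrite (lin_sum _ _ lin_bcls); apply: eq_bigr => p _; rewrite (linZ _ _ lin_bcls).
Qed.

Lemma bext_ext U (f g : B -> U) : lin f -> lin g ->
  (forall s, f (bcls X (word s)) = g (bcls X (word s))) -> f =1 g.
Proof.
move=> fl gl e x; have [t ->] := bcls_surj x.
apply: (talg_ext (f := fun t => f (bcls X t)) (g := fun t => g (bcls X t)) _ _ e).
- by lin.
- by lin.
Qed.

Let bmul_good (y t : T) : bker X y -> bcls X (tmul t y) = 0.
Proof.
move=> yk; apply: (talg_ext (f := fun t => bcls X (tmul t y)) (g := fun=> 0))
  => [||s]; [by lin|by lin|].
by apply: bcls_ker; apply: bker_mull.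
Qed.

Lemma bmul_bcls s t : bmul (bcls X s) (bcls X t) = bcls X (tmul s t).
Proof.
have g2 s' : bgood (fun t => bcls X (tmul s' t)).
  by split=> [|x xk]; [lin|apply: bmul_good].
rewrite /bmul blift_bcls ?blift_bcls //; split=> [c x y|x xk].
  by rewrite !blift_bcls //; apply: (_ : lin (fun x => bcls X (tmul x t))); lin.
rewrite blift_bcls //.
apply: (talg_ext (f := fun t => bcls X (tmul x t)) (g := fun=> 0))
  => [||r]; [by lin|by lin|].
by apply: bcls_ker; apply: bker_mulr.
Qed.

Lemma bmul_bilin : bilin (@bmul k A V X).
Proof.
split=> x c y z; have [x' ->] := bcls_surj x; have [y' ->] := bcls_surj y;
  have [z' ->] := bcls_surj z; rewrite -(linZ _ _ lin_bcls) -(linD lin_bcls) !bmul_bcls.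
  by apply: (_ : lin (fun y => bcls X (tmul y x'))); lin.
by apply: (_ : lin (fun y => bcls X (tmul x' y))); lin.
Qed.

Lemma bmul1l x : bmul (bone X) x = x.
Proof. by have [t ->] := bcls_surj x; rewrite bmul_bcls tmul1l. Qed.

Lemma bmul_incl v s : bmul (bincl X v) (bcls X (word s)) = bcls X (word (v :: s)).
Proof. by rewrite bmul_bcls -word_cons. Qed.

Lemma lin_bincl : lin (bincl X).
Proof. by rewrite /bincl; lin. Qed.

Lemma bact_bcls t a : bact (X := X) (bcls X t) a = bcls X (tact X t a).
Proof.
rewrite /bact blift_bcls //; split=> [|x xk]; first by lin.
by apply/bcls_ker/bker_tact.
Qed.

Lemma bact_bilin : bilin (@bact k A V X).
Proof.
split=> x c y z; last first.
  have [t ->] := bcls_surj x; rewrite !bact_bcls.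
  by apply: (_ : lin (fun a => bcls X (tact X t a))); lin.
have [y' ->] := bcls_surj y; have [z' ->] := bcls_surj z.
rewrite -(linZ _ _ lin_bcls) -(linD lin_bcls) !bact_bcls.
by apply: (_ : lin (fun y => bcls X (tact X y x))); lin.
Qed.

Lemma bact1 (x : B) : bact (X := X) x 1 = x.
Proof. by have [t ->] := bcls_surj x; rewrite bact_bcls tact1. Qed.

Fact tparity_multilin : multilin (fun s : seq V => (-1) ^+ size s *: word s).
Proof.
move=> s t c v w; rewrite !size_cat /= scalerA mulrC -scalerA -scalerDr.
by congr (_ *: _); apply: word_multilin.
Qed.

Lemma tparity_word (s : seq V) : tparity (word s) = (-1) ^+ size s *: word s.
Proof. exact/tlift_word/tparity_multilin. Qed.

Lemma lin_tparity : lin (@tparity k V).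
Proof. exact/lin_tlift/tparity_multilin. Qed.
Hint Resolve lin_tparity : lin.

(** The kernels are spanned by homogeneous elements, on which the parity is a scalar. *)
Fact tparity_good : bgood (fun t => bcls X (tparity t)).
Proof.
split=> [|x [n hx x0]]; first by lin.
suff -> : tparity x = (-1) ^+ n *: x.
  by rewrite (linZ _ _ lin_bcls) bcls_ker ?scaler0 //; exists n.
apply/eqP; rewrite -subr_eq0; apply/eqP.
apply: (lin_eq0_thomog (f := fun x => tparity x - (-1) ^+ n *: x) hx) => [|s <-].
  by lin.
by rewrite tparity_word subrr.
Qed.

Lemma bparity_bcls t : bparity (bcls X t) = bcls X (tparity t).
Proof. exact/blift_bcls/tparity_good. Qed.

Lemma lin_bparity : lin (@bparity k A V X).
Proof. exact/lin_blift/tparity_good. Qed.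

Lemma bparity_word s : bparity (bcls X (word s)) = (-1) ^+ size s *: bcls X (word s).
Proof. by rewrite bparity_bcls tparity_word (linZ _ _ lin_bcls). Qed.

Lemma thomog_lin n (x y : T) c : thomog n x -> thomog n y -> thomog n (c *: x + y).
Proof. by move=> /thomogP hx /thomogP hy; apply/thomogP; rewrite lin_tfilter hx hy. Qed.

Lemma thomog0 n : thomog n (0 : T).
Proof. by apply/thomogP; apply: lin0 (lin_tfilter _). Qed.

Lemma bhomog_lin n (x y : B) c : bhomog n x -> bhomog n y -> bhomog n (c *: x + y).
Proof.
move=> [s hs ->] [t ht ->]; exists (c *: s + t); first exact: thomog_lin.
by rewrite lin_bcls.
Qed.

Lemma bhomog0 n : bhomog n (0 : B).
Proof. by exists 0; [apply: thomog0|rewrite (lin0 lin_bcls)]. Qed.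

End BraidedExterior.

#[export] Hint Resolve lin_bcls bmul_bilin bact_bilin lin_bincl lin_bparity lin_tparity : lin.

(** * Components of low degree of the coaction and the coproduct *)

Section LowDegree.
Variables (k : fieldType) (V : lmodType k).
Local Notation T := (talg V).

Definition deg0 (x : T) : k^o := tlift (fun s => if s is [::] then 1 : k^o else 0) x.
Definition deg1 (x : T) : V := tlift (fun s => if s is [:: v] then v else 0) x.
Definition deg2 (x : T) : V ⊠ V :=
  tlift (fun s => if s is [:: v; w] then v ⊗ w else 0) x.

Fact deg0_multilin : multilin (fun s : seq V => if s is [::] then 1 : k^o else 0).
Proof. by move=> [|? ?] t /=; lin. Qed.

Fact deg1_multilin : multilin (fun s : seq V => if s is [:: v] then v else 0).
Proof. by move=> [|? [|? ?]] [|? ?] /=; lin. Qed.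

Fact deg2_multilin : multilin (fun s : seq V => if s is [:: v; w] then v ⊗ w else 0).
Proof. by move=> [|? [|? [|? ?]]] [|? [|? ?]] /=; lin. Qed.

Lemma lin_deg0 : lin deg0. Proof. exact/lin_tlift/deg0_multilin. Qed.
Lemma lin_deg1 : lin deg1. Proof. exact/lin_tlift/deg1_multilin. Qed.
Lemma lin_deg2 : lin deg2. Proof. exact/lin_tlift/deg2_multilin. Qed.
Hint Resolve lin_deg0 lin_deg1 lin_deg2 : lin.

Lemma deg0_word s : deg0 (word s) = if s is [::] then 1 else 0.
Proof. exact/tlift_word/deg0_multilin. Qed.

Lemma deg1_word s : deg1 (word s) = if s is [:: v] then v else 0.
Proof. exact/tlift_word/deg1_multilin. Qed.

Lemma deg2_word s : deg2 (word s) = if s is [:: v; w] then v ⊗ w else 0.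
Proof. exact/tlift_word/deg2_multilin. Qed.

Lemma deg0_cons v x : deg0 (tmul (word [:: v]) x) = 0.
Proof.
apply: (talg_ext (f := fun x => deg0 (tmul (word [:: v]) x)) (g := fun=> 0))
  => [||s]; [by lin|by lin|].
by rewrite tmul_word deg0_word.
Qed.

Lemma deg1_cons v x : deg1 (tmul (word [:: v]) x) = deg0 x *: v.
Proof.
apply: (talg_ext (f := fun x => deg1 (tmul _ x)) (g := fun x => deg0 x *: v))
  => [||s]; [by lin|by lin|].
by rewrite tmul_word deg1_word deg0_word; case: s => [|? ?]; rewrite /= ?scale1r ?scale0r.
Qed.

Lemma deg2_cons v x : deg2 (tmul (word [:: v]) x) = v ⊗ deg1 x.
Proof.
apply: (talg_ext (f := fun x => deg2 (tmul _ x)) (g := fun x => v ⊗ deg1 x))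
  => [||s]; [by lin|by lin|].
rewrite tmul_word deg2_word deg1_word; case: s => [|w [|? ?]] //=;
  by rewrite (lin0 (f := tens v)) //; lin.
Qed.

End LowDegree.

#[export] Hint Resolve lin_deg0 lin_deg1 lin_deg2 : lin.

Section LowDegreeCoproduct.
Variables (k : fieldType) (A : hopfType k) (V : lmodType k).
Variable X : crossed_ops A V.
Hypothesis XP : is_crossed X.
Implicit Types U : lmodType k.
Local Notation T := (talg V).

Fact wcoact_multilin : multilin (wcoact X).
Proof.
move=> s t; elim: s => [|u s IHs] /=; first by lin.
by apply: lin_sweedler_fun => v0 v1; apply: lin_sweedler; [lin|exact: IHs].
Qed.

Lemma lin_tcoact : lin (tcoact X).
Proof. exact/lin_tlift/wcoact_multilin. Qed.
Hint Resolve lin_tcoact : lin.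

Lemma tcoact_word s : tcoact X (word s) = wcoact X s.
Proof. exact/tlift_word/wcoact_multilin. Qed.

Lemma tcoact_counit t : \swd_(s0, s1 <- tcoact X t) (counit s1 *: s0) = t.
Proof.
apply: (talg_ext (f := fun t => \swd_(s0, s1 <- tcoact X t) (counit s1 *: s0)) (g := id))
  => [||s]; [by lin|exact: lin_id|].
elim: s => [|v s IHs]; rewrite tcoact_word.
  by rewrite swd_tens ?counit1 ?scale1r //; lin.
rewrite swd_swd; last by lin.
transitivity (\swd_(v0, v1 <- rcoact X v) (counit v1 *: word (v0 :: s))).
  apply: eq_swd => v0 v1; rewrite swd_swd; last by lin.
  rewrite (word_cons v0 s) -[in RHS]IHs tcoact_word.
  rewrite (lin_swd _ _ (g := fun x => counit v1 *: tmul (word [:: v0]) x)); last by lin.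
  apply: eq_swd => x0 x1; rewrite swd_tens; last by lin.
  by rewrite counitM -scalerA (linZ (f := tmul _)) //; lin.
by rewrite (swd_rcoact_counit XP (f := fun v => word (v :: s))) //; lin.
Qed.

(** The coaction preserves the degree and is trivial on the empty word. As in the lemmas that
    follow, the component is paired with an arbitrary linear map, so that the identity can be
    applied inside another Sweedler sum. *)
Lemma tcoact_deg0 U (f : A -> U) t : lin f ->
  \swd_(s0, s1 <- tcoact X t) (deg0 s0 *: f s1) = deg0 t *: f 1.
Proof.
move=> fl; apply: (talg_ext (f := fun t => \swd_(s0, s1 <- tcoact X t) (deg0 s0 *: f s1))
  (g := fun t => deg0 t *: f 1)) => [||[|v s]]; [by lin|by lin| |]; rewrite tcoact_word.
  by rewrite swd_tens //; lin.
rewrite deg0_word scale0r swd_swd; last by lin.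
rewrite -[RHS](swd0 _ (rcoact X v)); apply: eq_swd => v0 v1.
rewrite swd_swd; last by lin.
rewrite -[RHS](swd0 _ (wcoact X s)); apply: eq_swd => x0 x1.
by rewrite swd_tens ?deg0_cons ?scale0r //; lin.
Qed.

Lemma tcoact_deg1 U (F : V -> A -> U) t : bilin F ->
  \swd_(s0, s1 <- tcoact X t) F (deg1 s0) s1 = \swd_(v0, v1 <- rcoact X (deg1 t)) F v0 v1.
Proof.
move=> Fb; have F0 a : F 0 a = 0 by apply: (lin0 (f := F^~ a)); lin.
apply: (talg_ext (f := fun t => \swd_(s0, s1 <- tcoact X t) F (deg1 s0) s1)
  (g := fun t => \swd_(v0, v1 <- rcoact X (deg1 t)) F v0 v1))
  => [||[|v s]]; [by lin|by lin| |]; rewrite tcoact_word.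
  rewrite swd_tens ?deg1_word ?F0; last by lin.
  by rewrite (lin0 (f := fun v => sweedler (rcoact X v) F)) //; lin.
rewrite (word_cons v s) deg1_cons (linZ (f := fun v => sweedler (rcoact X v) F)); last by lin.
rewrite swd_swd -?swdZ; last by lin.
apply: eq_swd => v0 v1; rewrite swd_swd; last by lin.
rewrite -[v1 in RHS]mulr1 -(tcoact_deg0 (f := fun a => F v0 (v1 * a))); last by lin.
rewrite tcoact_word; apply: eq_swd => x0 x1.
by rewrite swd_tens ?deg1_cons ?(linZ (f := F^~ _)) //; lin.
Qed.

Fact tsbraid_multilin s :
  multilin (fun t => (-1) ^+ (size s * size t) *:
    (\swd_(y0, y1 <- wcoact X t) y0 ⊗ wact X s y1)).
Proof.
move=> t t' c v w; rewrite !size_cat /= scalerA mulrC -scalerA -scalerDr.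
congr (_ *: _).
apply: (_ : lin (fun v => \swd_(y0, y1 <- wcoact X (t ++ v :: t')) y0 ⊗ wact X s y1)).
by apply: lin_sweedler; [lin|exact: wcoact_multilin].
Qed.

Fact tsbraid_multilin2 y :
  multilin (fun s => tlift (fun t => (-1) ^+ (size s * size t) *:
    (\swd_(y0, y1 <- wcoact X t) y0 ⊗ wact X s y1)) y).
Proof.
move=> s s'; apply: lin_tlift_fun => t c v w.
rewrite !size_cat /= scalerA mulrC -scalerA -scalerDr; congr (_ *: _).
apply: (_ : lin (fun v => \swd_(y0, y1 <- wcoact X t) y0 ⊗ wact X (s ++ v :: s') y1)).
apply: lin_sweedler_fun => y0 y1.
apply: (lin_comp (g := tens y0) (h := fun v => wact X (s ++ v :: s') y1)); first by lin.
exact: wact_multilin.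
Qed.

Lemma tsbraid_bilin : bilin (tsbraid X).
Proof.
split=> x; first exact/lin_tlift/tsbraid_multilin2.
by apply: lin_tlift_fun => s; apply/lin_tlift/tsbraid_multilin.
Qed.
Hint Resolve tsbraid_bilin : lin.

Lemma tsbraid_word s t : tsbraid X (word s) (word t) =
  (-1) ^+ (size s * size t) *: \swd_(y0, y1 <- wcoact X t) y0 ⊗ wact X s y1.
Proof.
rewrite /tsbraid tlift_word; last exact: tsbraid_multilin2.
by rewrite tlift_word //; apply: tsbraid_multilin.
Qed.

Lemma tsbraid1l x : tsbraid X (word [::]) x = x ⊗ word [::].
Proof.
apply: (talg_ext (f := tsbraid X _) (g := fun x => x ⊗ word [::]))
  => [||s]; [by lin|by lin|].
rewrite tsbraid_word mul0n expr0 scale1r -[in RHS](tcoact_counit (word s)).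
rewrite tcoact_word (lin_swd _ _ (g := fun x => x ⊗ _)); last by lin.
apply: eq_swd => y0 y1 /=.
by rewrite (linZ (f := tens y0)) ?(linZ (f := fun x => x ⊗ word [::])) //; lin.
Qed.

Lemma wact_letter v a : wact X [:: v] a = word [:: ract X v a].
Proof.
rewrite -(swd_counitr (f := fun a => word [:: ract X v a])); last by lin.
by apply: eq_swd => a1 a2; rewrite (linZ (f := tmul _)) ?tmul1r //; lin.
Qed.

Fact tsmul2_bilin : bilin (tsmul2 X).
Proof. by rewrite /tsmul2; lin. Qed.

Fact wcomul_multilin : multilin (wcomul X).
Proof.
move=> s t; elim: s => [|u s IHs] /=; have tb := tsmul2_bilin.
  apply: (lin_comp (g := fun p => tsmul2 X p _)
    (h := fun v => word [:: v] ⊗ word [::] + word [::] ⊗ word [:: v])); by lin.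
by apply: (lin_comp (g := tsmul2 X _) (h := fun v => wcomul X (s ++ v :: t))); first by lin.
Qed.

Lemma lin_tcomul : lin (tcomul X).
Proof. exact/lin_tlift/wcomul_multilin. Qed.
Hint Resolve lin_tcomul : lin.

Lemma tcomul_word s : tcomul X (word s) = wcomul X s.
Proof. exact/tlift_word/wcomul_multilin. Qed.

(** The product of [v ⊗ 1] with [c ⊗ d] is [vc ⊗ d], whereas the [v] of [1 ⊗ v] has to be braided
    past [c] before it reaches [d]. *)
Lemma swd_tcomul_cons U (G : T -> T -> U) v s : bilin G ->
  \swd_(s1, s2 <- tcomul X (word (v :: s))) G s1 s2 =
  \swd_(c, d <- tcomul X (word s)) (G (tmul (word [:: v]) c) d +
    \swd_(c', b <- tsbraid X (word [:: v]) c) G c' (tmul b d)).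
Proof.
move=> Gb; rewrite !tcomul_word /= /tsmul2 (linD (f := fun p =>
  \swd_(a, b <- p) \swd_(c, d <- wcomul X s)
     \swd_(c', b' <- tsbraid X b c) tmul a c' ⊗ tmul b' d)); last by lin.
rewrite !swd_tens; [|by lin..].
rewrite (linD (f := fun p => sweedler p G)) ?swdD; last by lin.
congr (_ + _); rewrite swd_swd //; apply: eq_swd => c d.
  rewrite tsbraid1l swd_tens ?tmul1l; last by lin.
  by rewrite swd_tens.
rewrite swd_swd //; apply: eq_swd => c' b.
by rewrite swd_tens // tmul1l.
Qed.

Lemma tsbraid_deg0 U (f : T -> U) v c : lin f ->
  \swd_(c', b <- tsbraid X (word [:: v]) c) (deg0 c' *: f b) = deg0 c *: f (word [:: v]).
Proof.
move=> fl; apply: (talg_ext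
  (f := fun c => \swd_(c', b <- tsbraid X (word [:: v]) c) (deg0 c' *: f b))
  (g := fun c => deg0 c *: f (word [:: v]))) => [||s]; [by lin|by lin|].
rewrite tsbraid_word (linZ (f := fun t => \swd_(c', b <- t) (deg0 c' *: f b))); last by lin.
rewrite swd_swd; last by lin.
transitivity ((-1) ^+ (1 * size s) *: \swd_(y0, y1 <- tcoact X (word s))
    (deg0 y0 *: f (word [:: ract X v y1]))).
  rewrite tcoact_word; congr (_ *: _); apply: eq_swd => y0 y1.
  by rewrite swd_tens ?wact_letter //; lin.
rewrite (tcoact_deg0 (f := fun a => f (word [:: ract X v a]))) ?ract1 //; last by lin.
by rewrite deg0_word; case: s => [|? ?]; rewrite /= ?scale1r // !scale0r scaler0.
Qed.

Lemma tsbraid_deg1 U (F : V -> T -> U) v c : bilin F ->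
  \swd_(c', b <- tsbraid X (word [:: v]) c) F (deg1 c') b =
  - \swd_(v0, v1 <- rcoact X (deg1 c)) F v0 (word [:: ract X v v1]).
Proof.
move=> Fb; apply: (talg_ext
  (f := fun c => \swd_(c', b <- tsbraid X (word [:: v]) c) F (deg1 c') b)
  (g := fun c => - \swd_(v0, v1 <- rcoact X (deg1 c)) F v0 (word [:: ract X v v1])))
  => [||s]; [by lin|by lin|].
rewrite tsbraid_word (linZ (f := fun t => \swd_(c', b <- t) F (deg1 c') b)); last by lin.
rewrite swd_swd; last by lin.
transitivity ((-1) ^+ (1 * size s) *: \swd_(y0, y1 <- tcoact X (word s))
    F (deg1 y0) (word [:: ract X v y1])).
  rewrite tcoact_word; congr (_ *: _); apply: eq_swd => y0 y1.
  by rewrite swd_tens ?wact_letter //; lin.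
rewrite (tcoact_deg1 (F := fun w a => F w (word [:: ract X v a]))); last by lin.
rewrite deg1_word; case: s => [|w [|? ?]]; rewrite /= ?expr1 ?scaleN1r //.
all: by rewrite !(lin0 (f := fun w => sweedler (rcoact X w) _)) ?scaler0 ?oppr0 //; lin.
Qed.

(** Braiding [v] past anything leaves a single letter in the second place. With a [G] that contains
    [deg0] of that place, this discards the braided summand of the coproduct. *)
Lemma tsbraid_letter U (G : T -> T -> U) v c : bilin G ->
  (forall x u, G x (word [:: u]) = 0) ->
  \swd_(c', b <- tsbraid X (word [:: v]) c) G c' b = 0.
Proof.
move=> Gb G0; apply: (talg_ext
  (f := fun c => \swd_(c', b <- tsbraid X (word [:: v]) c) G c' b) (g := fun=> 0))
  => [||s]; [by lin|by lin|].
rewrite tsbraid_word (linZ (f := fun t => sweedler t G)) ?swd_swd; [|by lin..].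
rewrite -[RHS](scaler0 _ ((-1) ^+ (1 * size s))) -(swd0 _ (wcoact X s)); congr (_ *: _).
by apply: eq_swd => y0 y1; rewrite swd_tens // wact_letter.
Qed.

Lemma tcomul_deg0l U (f : T -> U) t : lin f ->
  \swd_(s1, s2 <- tcomul X t) (deg0 s1 *: f s2) = f t.
Proof.
move=> fl; apply: (talg_ext
  (f := fun t => \swd_(s1, s2 <- tcomul X t) (deg0 s1 *: f s2)) (g := f)) => [|//|s].
  by lin.
elim: s f fl => [|v s IHs] f fl.
  by rewrite tcomul_word swd_tens ?deg0_word ?scale1r //; lin.
rewrite swd_tcomul_cons; last by lin.
rewrite (word_cons v s) -(IHs (fun x => f (tmul (word [:: v]) x))); last by lin.
apply: eq_swd => c d; rewrite deg0_cons scale0r add0r.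
by rewrite (tsbraid_deg0 _ _ (f := fun b => f (tmul b d))) //; lin.
Qed.

Lemma tcomul_deg1l U (f : V -> U) t : lin f ->
  \swd_(s1, s2 <- tcomul X t) (deg0 s2 *: f (deg1 s1)) = f (deg1 t).
Proof.
move=> fl; apply: (talg_ext
  (f := fun t => \swd_(s1, s2 <- tcomul X t) (deg0 s2 *: f (deg1 s1)))
  (g := fun t => f (deg1 t))) => [||[|v s]]; [by lin|by lin| |].
  by rewrite tcomul_word swd_tens ?deg1_word ?(lin0 fl) ?scaler0 //; lin.
rewrite swd_tcomul_cons; last by lin.
rewrite (word_cons v s) deg1_cons (linZ _ _ fl).
rewrite -(tcomul_deg0l _ (f := fun d => deg0 d *: f v)); last by lin.
apply: eq_swd => c d; rewrite tsbraid_letter ?addr0; first last.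
- by move=> x u; rewrite deg0_cons scale0r.
- by lin.
by rewrite deg1_cons (linZ _ _ fl) !scalerA mulrC.
Qed.

(** The (1,1) component of the coproduct is [2, -Psi]: in degree 2 the letters [v] and [w] either
    stay in order, or [v] is braided past [w] with a sign. *)
Lemma tcomul_deg11 U (F : V -> V -> U) t : bilin F ->
  \swd_(s1, s2 <- tcomul X t) F (deg1 s1) (deg1 s2) =
  sweedler (deg2 t - Psi X (deg2 t)) F.
Proof.
move=> Fb; apply: (talg_ext
  (f := fun t => \swd_(s1, s2 <- tcomul X t) F (deg1 s1) (deg1 s2))
  (g := fun t => sweedler (deg2 t - Psi X (deg2 t)) F)) => [||[|v s]]; [by lin|by lin| |].
  have F0 : F 0 0 = 0 by apply: (lin0 (f := F 0)); lin.
  have s0 : sweedler 0 F = 0 by apply: (lin0 (f := fun t => sweedler t F)); lin.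
  rewrite tcomul_word swd_tens ?deg1_word ?deg2_word ?F0; last by lin.
  by rewrite (lin0 (lin_Psi XP)) subr0 s0.
rewrite swd_tcomul_cons ?swdD; last by lin.
rewrite (word_cons v s) deg2_cons (linB (f := fun u => sweedler u F)); last by lin.
congr (_ + _).
  rewrite swd_tens // -(tcomul_deg0l _ (f := fun d => F v (deg1 d))); last by lin.
  by apply: eq_swd => c d; rewrite deg1_cons (linZ (f := F^~ _)) //; lin.
(* In the braided summand [v] fills the second factor to degree 1, so [d] contributes only through
   [deg0] and [tcomul_deg1l] applies. *)
pose g (w : V) := \swd_(v0, v1 <- rcoact X w) F v0 (ract X v v1).
have gl : lin g by rewrite /g; lin.
transitivity (- g (deg1 (word s))); last first.
  rewrite Psi_tens // swd_swd //; congr (- _); apply: eq_swd => v0 v1.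
  by rewrite swd_tens.
rewrite -(tcomul_deg1l _ gl) -swdN; apply: eq_swd => c d.
rewrite (tsbraid_deg1 _ _ (F := fun w b => F w (deg1 (tmul b d)))); last by lin.
congr (- _); apply: etrans (swdZ _ _ _); apply: eq_swd => v0 v1.
by rewrite deg1_cons (linZ (f := F _)) //; lin.
Qed.

Lemma deg2_braid x : deg2 (tbraid (negPsi X) 0 x) = negPsi X (deg2 x).
Proof.
have nl := lin_negPsi XP.
apply: (talg_ext (f := fun x => deg2 (tbraid (negPsi X) 0 x))
  (g := fun x => negPsi X (deg2 x))) => [||s]; [by lin|by lin|].
case: s => [|v [|w s]].
- by rewrite tbraid_nil // deg2_word (lin0 nl) (lin0 (@lin_deg2 _ _)).
- by rewrite tbraid0_letter // deg2_word (lin0 nl) (lin0 (@lin_deg2 _ _)).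
rewrite tbraid0_word // deg2_word (lin_swd _ _ (@lin_deg2 _ _)).
under eq_swd do rewrite deg2_word.
by case: s => [|? ?]; rewrite ?swd_id // swd0 (lin0 nl).
Qed.

(** On homogeneous elements of degree 0 and 1 the factorial is the identity, and in degree 2 it is
    id - Psi. Hence nothing is divided out below degree 2, and id - Psi kills what is divided out
    there; this is the content of this lemma and the next two. *)
Lemma bker_deg0 x : bker X x -> deg0 x = 0.
Proof.
move=> [[|n] hx x0].
  by rewrite (_ : x = 0) ?(lin0 (@lin_deg0 _ _)).
by apply: (lin_eq0_thomog hx); [lin|case=> // v s _; rewrite deg0_word].
Qed.

Lemma bker_deg1 x : bker X x -> deg1 x = 0.
Proof.
have nl := lin_negPsi XP.
move=> [n hx x0]; have [n1|n1] := eqVneq n 1%N.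
  subst n; move: x0; rewrite braided_fact_homog //= (lin0 (lin_tbraid _ _)) // addr0 => ->.
  exact: lin0 (@lin_deg1 _ _).
apply: (lin_eq0_thomog hx); [by lin|move=> s sn; rewrite deg1_word].
by case: s sn => [|? [|? ?]] //= n1'; rewrite -n1' in n1.
Qed.

Lemma bker_deg2 x : bker X x -> deg2 x - Psi X (deg2 x) = 0.
Proof.
have nl := lin_negPsi XP.
move=> [n hx x0]; have [n2|n2] := eqVneq n 2%N.
  subst n; rewrite -[- Psi X _]/(negPsi X _) -deg2_braid -(linD (@lin_deg2 _ _)).
  move: x0; rewrite braided_fact_homog //= !(lin0 (lin_tbraid _ _)) // !addr0 => ->.
  exact: lin0 (@lin_deg2 _ _).
suff -> : deg2 x = 0 by rewrite (lin0 (lin_Psi XP)) subr0.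
apply: (lin_eq0_thomog hx); [by lin|move=> s sn; rewrite deg2_word].
by case: s sn => [|? [|? [|? ?]]] //= n2'; rewrite -n2' in n2.
Qed.

End LowDegreeCoproduct.

#[export] Hint Resolve lin_tcoact lin_tcomul : lin.

(** * Differentials on the bosonisation *)

Section LowDegreeExterior.
Variables (k : fieldType) (A : hopfType k) (V : lmodType k).
Variable X : crossed_ops A V.
Hypothesis XP : is_crossed X.
Implicit Types U : lmodType k.
Local Notation B := (bext X).

Definition bdeg0 (x : B) : k^o := blift (@deg0 k V) x.
Definition bdeg1 (x : B) : V := blift (@deg1 k V) x.
(** [deg2] need not descend to the quotient; its composite with id - Psi does, and is injective on
    degree 2. By [bcomul_deg11] it is the (1,1) component of the coproduct. *)
Definition bdeg11 (x : B) : V ⊠ V := blift (fun t => deg2 t - Psi X (deg2 t)) x.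

Fact bdeg0_good : bgood X (@deg0 k V).
Proof. by split; [lin|apply: bker_deg0]. Qed.

Fact bdeg1_good : bgood X (@deg1 k V).
Proof. by split; [lin|apply: bker_deg1]. Qed.

Fact bdeg11_good : bgood X (fun t => deg2 t - Psi X (deg2 t)).
Proof. by split; [lin|apply: bker_deg2]. Qed.

Lemma lin_bdeg0 : lin bdeg0. Proof. exact/lin_blift/bdeg0_good. Qed.
Lemma lin_bdeg1 : lin bdeg1. Proof. exact/lin_blift/bdeg1_good. Qed.
Lemma lin_bdeg11 : lin bdeg11. Proof. exact/lin_blift/bdeg11_good. Qed.
Hint Resolve lin_bdeg0 lin_bdeg1 lin_bdeg11 : lin.

Lemma bdeg0_bcls t : bdeg0 (bcls X t) = deg0 t.
Proof. exact/blift_bcls/bdeg0_good. Qed.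

Lemma bdeg1_bcls t : bdeg1 (bcls X t) = deg1 t.
Proof. exact/blift_bcls/bdeg1_good. Qed.

Lemma bdeg11_bcls t : bdeg11 (bcls X t) = deg2 t - Psi X (deg2 t).
Proof. exact: (blift_bcls _ bdeg11_good). Qed.

Lemma bdeg1_incl v : bdeg1 (bincl X v) = v.
Proof. by rewrite bdeg1_bcls deg1_word. Qed.

Lemma bdeg0_homog n x : bhomog n.+1 x -> bdeg0 x = 0.
Proof.
move=> [t ht ->]; rewrite bdeg0_bcls; apply: (lin_eq0_thomog ht); first by lin.
by move=> [|v s] // _; rewrite deg0_word.
Qed.

Lemma bdeg1_homog n x : bhomog n.+2 x -> bdeg1 x = 0.
Proof.
move=> [t ht ->]; rewrite bdeg1_bcls; apply: (lin_eq0_thomog ht); first by lin.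
by move=> [|v [|w s]] // _; rewrite deg1_word.
Qed.

(* Neither [bcoact] nor [bcomul] is shown to be well defined on the quotient:
   their low-degree components below are, and suffice. *)
Lemma swd_bcoact U (G : B -> A -> U) t : bilin G ->
  (forall x, bker X x -> \swd_(s0, s1 <- tcoact X x) G (bcls X s0) s1 = 0) ->
  \swd_(f0, f1 <- bcoact (bcls X t)) G f0 f1 =
  \swd_(s0, s1 <- tcoact X t) G (bcls X s0) s1.
Proof.
move=> Gb G0; rewrite (lin_blift_out _ _ (g := fun u => sweedler u G)); last by lin.
have E x : sweedler (\swd_(s0, s1 <- tcoact X x) bcls X s0 ⊗ s1) G =
    \swd_(s0, s1 <- tcoact X x) G (bcls X s0) s1.
  by rewrite swd_swd //; apply: eq_swd => s0 s1; rewrite swd_tens.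
rewrite blift_bcls ?E //; split=> [|x xk]; first by lin.
by rewrite E G0.
Qed.

Lemma swd_bcomul U (G : B -> B -> U) t : bilin G ->
  (forall x, bker X x -> \swd_(s1, s2 <- tcomul X x) G (bcls X s1) (bcls X s2) = 0) ->
  \swd_(e1, e2 <- bcomul (bcls X t)) G e1 e2 =
  \swd_(s1, s2 <- tcomul X t) G (bcls X s1) (bcls X s2).
Proof.
move=> Gb G0; rewrite (lin_blift_out _ _ (g := fun u => sweedler u G)); last by lin.
have E x : sweedler (\swd_(s1, s2 <- tcomul X x) bcls X s1 ⊗ bcls X s2) G =
    \swd_(s1, s2 <- tcomul X x) G (bcls X s1) (bcls X s2).
  by rewrite swd_swd //; apply: eq_swd => s0 s1; rewrite swd_tens.
rewrite blift_bcls ?E //; split=> [|x xk]; first by lin.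
by rewrite E G0.
Qed.

Lemma bcoact_deg0 U (f : A -> U) x : lin f ->
  \swd_(f0, f1 <- bcoact x) (bdeg0 f0 *: f f1) = bdeg0 x *: f 1.
Proof.
move=> fl; have [t ->] := bcls_surj x.
have E y : \swd_(s0, s1 <- tcoact X y) (bdeg0 (bcls X s0) *: f s1) = deg0 y *: f 1.
  by rewrite -(tcoact_deg0 XP) //; apply: eq_swd => s0 s1; rewrite bdeg0_bcls.
rewrite (swd_bcoact _ (G := fun f0 f1 => bdeg0 f0 *: f f1)) ?E ?bdeg0_bcls //.
  by lin.
by move=> y yk; rewrite E (bker_deg0 yk) scale0r.
Qed.

Lemma bcoact_deg1 U (F : V -> A -> U) x : bilin F ->
  \swd_(f0, f1 <- bcoact x) F (bdeg1 f0) f1 = \swd_(v0, v1 <- rcoact X (bdeg1 x)) F v0 v1.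
Proof.
move=> Fb; have [t ->] := bcls_surj x.
have E y : \swd_(s0, s1 <- tcoact X y) F (bdeg1 (bcls X s0)) s1 =
    \swd_(v0, v1 <- rcoact X (deg1 y)) F v0 v1.
  by rewrite -(tcoact_deg1 XP) //; apply: eq_swd => s0 s1; rewrite bdeg1_bcls.
rewrite (swd_bcoact _ (G := fun f0 f1 => F (bdeg1 f0) f1)) ?E ?bdeg1_bcls //.
  by lin.
move=> y yk; rewrite E (bker_deg1 XP yk).
by apply: (lin0 (f := fun v => sweedler (rcoact X v) F)); lin.
Qed.

Lemma bcomul_deg0l U (f : B -> U) x : lin f ->
  \swd_(e1, e2 <- bcomul x) (bdeg0 e1 *: f e2) = f x.
Proof.
move=> fl; have [t ->] := bcls_surj x.
have E y : \swd_(s1, s2 <- tcomul X y) (bdeg0 (bcls X s1) *: f (bcls X s2)) = f (bcls X y).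
  rewrite -(tcomul_deg0l XP y (f := fun y => f (bcls X y))); last by lin.
  by apply: eq_swd => s0 s1; rewrite bdeg0_bcls.
rewrite (swd_bcomul _ (G := fun e1 e2 => bdeg0 e1 *: f e2)) ?E //; first by lin.
by move=> y yk; rewrite E bcls_ker // (lin0 fl).
Qed.

Lemma bcomul_deg1l U (f : V -> U) x : lin f ->
  \swd_(e1, e2 <- bcomul x) (bdeg0 e2 *: f (bdeg1 e1)) = f (bdeg1 x).
Proof.
move=> fl; have [t ->] := bcls_surj x.
have E y : \swd_(s1, s2 <- tcomul X y)
    (bdeg0 (bcls X s2) *: f (bdeg1 (bcls X s1))) = f (deg1 y).
  rewrite -(tcomul_deg1l XP) //.
  by apply: eq_swd => s0 s1; rewrite bdeg0_bcls bdeg1_bcls.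
rewrite (swd_bcomul _ (G := fun e1 e2 => bdeg0 e2 *: f (bdeg1 e1))) ?E ?bdeg1_bcls //.
  by lin.
by move=> y yk; rewrite E (bker_deg1 XP yk) (lin0 fl).
Qed.

Lemma bcomul_deg11 U (F : V -> V -> U) x : bilin F ->
  \swd_(e1, e2 <- bcomul x) F (bdeg1 e1) (bdeg1 e2) = sweedler (bdeg11 x) F.
Proof.
move=> Fb; have [t ->] := bcls_surj x.
have E y : \swd_(s1, s2 <- tcomul X y) F (bdeg1 (bcls X s1)) (bdeg1 (bcls X s2)) =
    sweedler (deg2 y - Psi X (deg2 y)) F.
  rewrite -(tcomul_deg11 XP) //.
  by apply: eq_swd => s0 s1; rewrite !bdeg1_bcls.
rewrite (swd_bcomul _ (G := fun e1 e2 => F (bdeg1 e1) (bdeg1 e2))) ?E ?bdeg11_bcls //.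
  by lin.
move=> y yk; rewrite E (bker_deg2 XP yk).
by apply: (lin0 (f := fun u => sweedler u F)); lin.
Qed.

End LowDegreeExterior.

#[export] Hint Resolve lin_bdeg0 lin_bdeg1 lin_bdeg11 : lin.

Section Smash.
Variables (k : fieldType) (A : hopfType k) (V : lmodType k).
Variable X : crossed_ops A V.
Hypothesis XP : is_crossed X.
Implicit Types U : lmodType k.
Local Notation B := (bext X).
Local Notation smash := (smash X).

Lemma smash_ext U (f g : smash -> U) : lin f -> lin g ->
  (forall a s, f (a ⊗ bcls X (word s)) = g (a ⊗ bcls X (word s))) -> f =1 g.
Proof.
move=> fl gl e; apply: tensor_ext => // a.
by apply: bext_ext => [||s]; [lin|lin|exact: e].
Qed.

Lemma shomog_tens n a (x : B) : bhomog n x -> shomog n (a ⊗ x : smash).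
Proof.
move=> hx; exists [:: (a, x)]; last by rewrite big_seq1.
by move=> p; rewrite inE => /eqP ->.
Qed.

Lemma lin_eq0_shomog U (f : smash -> U) n x : shomog n x -> lin f ->
  (forall a y, bhomog n y -> f (a ⊗ y) = 0) -> f x = 0.
Proof.
move=> [s hs ->] fl f0; rewrite lin_sum // big_seq big1 // => p ps.
exact/f0/hs.
Qed.

Lemma smul_bilin : bilin (@smul k A V X).
Proof. by rewrite /smul; lin. Qed.
Hint Resolve smul_bilin : lin.

Lemma smul_tens1 a (x y : B) : smul (a ⊗ x : smash) (1 ⊗ y) = a ⊗ bmul x y.
Proof.
rewrite /smul swd_tens; last by lin.
rewrite swd_tens; last by lin.
by rewrite comul1 swd_tens ?mulr1 ?bact1 //; lin.
Qed.

Lemma lin_sparity : lin (@sparity k A V X).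
Proof. by rewrite /sparity; lin. Qed.
Hint Resolve lin_sparity : lin.

Lemma sparity_tens a (x : B) : sparity (a ⊗ x : smash) = a ⊗ bparity x.
Proof. by rewrite /sparity swd_tens //; lin. Qed.

(** [sdeg0] keeps the factor [A], as it has to produce the left coaction of [A]. The other two apply
    the counit to it, which loses nothing on left-invariant elements [1 ⊗ e]. *)
Definition sdeg0 (x : smash) : A := \swd_(a, e <- x) (bdeg0 e *: a).
Definition sdeg1 (x : smash) : V := \swd_(a, e <- x) (counit a *: bdeg1 e).
Definition sinvariant (x : smash) : B := \swd_(a, e <- x) (counit a *: e).

Lemma lin_sdeg0 : lin sdeg0. Proof. by rewrite /sdeg0; lin. Qed.
Lemma lin_sdeg1 : lin sdeg1. Proof. by rewrite /sdeg1; lin. Qed.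
Lemma lin_sinvariant : lin sinvariant. Proof. by rewrite /sinvariant; lin. Qed.
Hint Resolve lin_sdeg0 lin_sdeg1 lin_sinvariant : lin.

Lemma sdeg0_tens a e : sdeg0 (a ⊗ e) = bdeg0 e *: a.
Proof. by rewrite /sdeg0 swd_tens //; lin. Qed.

Lemma sdeg1_tens a e : sdeg1 (a ⊗ e) = counit a *: bdeg1 e.
Proof. by rewrite /sdeg1 swd_tens //; lin. Qed.

Lemma sinvariant_tens a e : sinvariant (a ⊗ e) = counit a *: e.
Proof. by rewrite /sinvariant swd_tens //; lin. Qed.

Lemma sdeg0_homog n x : shomog n.+1 x -> sdeg0 x = 0.
Proof.
move=> hx; apply: (lin_eq0_shomog hx); first by lin.
by move=> a y hy; rewrite sdeg0_tens (bdeg0_homog hy) scale0r.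
Qed.

Lemma sdeg1_homog n x : shomog n.+2 x -> sdeg1 x = 0.
Proof.
move=> hx; apply: (lin_eq0_shomog hx); first by lin.
by move=> a y hy; rewrite sdeg1_tens (bdeg1_homog XP hy) scaler0.
Qed.

Lemma sinvariant_homog n x : shomog n x -> bhomog n (sinvariant x).
Proof.
move=> [s hs ->]; rewrite lin_sum; last exact: lin_sinvariant.
elim: s hs => [|p s IHs] hs; first by rewrite big_nil; apply: bhomog0.
rewrite big_cons sinvariant_tens; apply: bhomog_lin; first by apply: hs; rewrite mem_head.
by apply: IHs => q qs; apply: hs; rewrite in_cons qs orbT.
Qed.

Lemma sdeg0_sparity x : sdeg0 (sparity x) = sdeg0 x.
Proof.
apply: (smash_ext (f := fun x => sdeg0 (sparity x))) => [||a s]; [by lin|by lin|].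
rewrite sparity_tens bparity_word // !sdeg0_tens (linZ (f := @bdeg0 _ _ _ _)); last by lin.
by case: s => [|v s]; rewrite ?scale1r // bdeg0_bcls deg0_word scaler0.
Qed.

Lemma sdeg1_sparity x : sdeg1 (sparity x) = - sdeg1 x.
Proof.
apply: (smash_ext (f := fun x => sdeg1 (sparity x)) (g := fun x => - sdeg1 x))
  => [||a s]; [by lin|by lin|].
rewrite sparity_tens bparity_word // !sdeg1_tens (linZ (f := @bdeg1 _ _ _ _)); last by lin.
rewrite !bdeg1_bcls // !deg1_word.
by case: s => [|v [|w s]]; rewrite ?scaleN1r ?scalerN // !scaler0 oppr0.
Qed.

Lemma swd_scomul U (G : smash -> smash -> U) x : bilin G ->
  sweedler (scomul x) G =
  \swd_(a, e <- x) \swd_(a1, a2 <- comul a) \swd_(e1, e2 <- bcomul e)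
    \swd_(f0, f1 <- bcoact e1) G (a1 ⊗ f0) ((a2 * f1) ⊗ e2).
Proof.
move=> Gb; rewrite swd_swd //; apply: eq_swd => a e.
rewrite swd_swd //; apply: eq_swd => a1 a2.
rewrite swd_swd //; apply: eq_swd => e1 e2.
by rewrite swd_swd //; apply: eq_swd => f0 f1; rewrite swd_tens.
Qed.

(** The right side is the left coaction of [A] on the bosonisation, for which the elements [1 ⊗ e]
    are invariant. *)
Lemma scomul_deg0l x :
  \swd_(x1, x2 <- scomul x) (sdeg0 x1 ⊗ x2) =
  \swd_(a, e <- x) \swd_(a1, a2 <- comul a) a1 ⊗ (a2 ⊗ e).
Proof.
rewrite (swd_scomul _ (G := fun x1 x2 => sdeg0 x1 ⊗ x2)); last by lin.
apply: eq_swd => a e; apply: eq_swd => a1 a2.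
rewrite -[RHS](bcomul_deg0l XP (f := fun e => a1 ⊗ (a2 ⊗ e))); last by lin.
apply: eq_swd => e1 e2; rewrite -[in RHS](mulr1 a2).
rewrite -(bcoact_deg0 XP _ (f := fun f1 => a1 ⊗ (a2 * f1 ⊗ e2))); last by lin.
apply: eq_swd => f0 f1; rewrite sdeg0_tens (linZ (f := fun x => x ⊗ _)) //; lin.
Qed.

(** The counits in [sdeg1] remove the coaction that the bosonisation inserts into the coproduct,
    which leaves the (1,1) component of the braided one. *)
Lemma scomul_deg11 e :
  \swd_(x1, x2 <- scomul (1 ⊗ e : smash)) (sdeg1 x1 ⊗ sdeg1 x2) = bdeg11 e.
Proof.
rewrite (swd_scomul _ (G := fun x1 x2 => sdeg1 x1 ⊗ sdeg1 x2)); last by lin.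
transitivity (\swd_(a, e <- (1 ⊗ e : smash)) \swd_(a1, a2 <- comul a)
    \swd_(x, y <- bdeg11 e) (counit a1 *: (counit a2 *: (x ⊗ y)))).
  apply: eq_swd => {}a {}e; apply: eq_swd => a1 a2.
  rewrite -(bcomul_deg11 XP _ (F := fun x y =>
    counit a1 *: (counit a2 *: (x ⊗ y)))); last by lin.
  apply: eq_swd => e1 e2.
  rewrite -(swd_rcoact_counit XP (f := fun v =>
    counit a1 *: (counit a2 *: (v ⊗ bdeg1 e2)))); last by lin.
  rewrite -(bcoact_deg1 XP _ (F := fun v f1 => counit f1 *:
    (counit a1 *: (counit a2 *: (v ⊗ bdeg1 e2))))); last by lin.
  apply: eq_swd => f0 f1; rewrite !sdeg1_tens counitM.
  rewrite (linZ (f := fun x => x ⊗ _)) ?(linZ (f := fun x => tens _ x)); [|by lin..].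
  by rewrite !scalerA; congr (_ *: _); rewrite -[RHS]mulrA [RHS]mulrC !mulrA.
rewrite swd_tens; last by lin.
rewrite comul1 swd_tens; last by lin.
by rewrite -[RHS]swd_id; apply: eq_swd => x y; rewrite counit1 !scale1r.
Qed.

End Smash.

#[export] Hint Resolve smul_bilin lin_sparity lin_sdeg0 lin_sdeg1 lin_sinvariant : lin.

Section Augmentation.
Variables (k : fieldType) (A : hopfType k).

Lemma lin_aug_proj : lin (@aug_proj k A).
Proof.
move=> c x y; apply: val_inj; rewrite linearP /= linearP /= scalerDl scalerBr scalerA.
by rewrite opprD addrACA.
Qed.

Lemma aug_proj1 : aug_proj (1 : A) = 0.
Proof. by apply: val_inj; rewrite /= counit1 scale1r subrr. Qed.

End Augmentation.

#[export] Hint Resolve lin_aug_proj : lin.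

(** * Degree two and preimages under [2, -Psi] *)

Section DegreeTwo.
Variables (k : fieldType) (A : hopfType k) (V : lmodType k).
Variable X : crossed_ops A V.
Hypothesis XP : is_crossed X.
Local Notation B := (bext X).

Lemma lin_tdeg2 : lin (@tdeg2 k V).
Proof. by rewrite /tdeg2; lin. Qed.
Hint Resolve lin_tdeg2 : lin.

Lemma tdeg2_tens (v w : V) : tdeg2 (v ⊗ w) = word [:: v; w].
Proof. by rewrite /tdeg2 swd_tens //; lin. Qed.

Lemma thomog_tdeg2 (th : V ⊠ V) : thomog 2 (tdeg2 th).
Proof.
apply/thomogP; apply: (tensor_ext (f := fun th => tfilter _ (tdeg2 th))) => [||v w];
  [by lin|by lin|].
by rewrite tdeg2_tens tfilter_word.
Qed.

Lemma thomog2E (x : talg V) : thomog 2 x -> x = tdeg2 (deg2 x).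
Proof.
move=> hx; apply/eqP; rewrite -subr_eq0; apply/eqP.
apply: (lin_eq0_thomog (f := fun x => x - tdeg2 (deg2 x)) hx); first by lin.
by move=> [|v [|w [|u s]]] // _; rewrite deg2_word tdeg2_tens subrr.
Qed.

Lemma braided_int2 th : braided_int (negPsi X) 2 (tdeg2 th) = tdeg2 (th - Psi X th).
Proof.
have nl := lin_negPsi XP.
rewrite braided_intE //= (lin0 (lin_tbraid _ _)) // addr0 (linD lin_tdeg2).
congr (_ + _); apply: (tensor_ext (f := fun th => tbraid (negPsi X) 0 (tdeg2 th))
  (g := fun th => tdeg2 (- Psi X th))) => [||v w]; [by lin|by lin|].
by rewrite tdeg2_tens tbraid0_word.
Qed.

Lemma bprod2E th : bprod2 X th = bcls X (tdeg2 th).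
Proof.
rewrite (lin_swd _ _ (@lin_bcls _ _ _ X)); apply: eq_swd => v w.
by rewrite bmul_incl.
Qed.

(** The difference of two preimages is killed by [2, -Psi], hence by [2, -Psi]!, so its class in the
    quotient is 0. *)
Lemma bprod2_braided_int th th' :
  braided_int (negPsi X) 2 (tdeg2 th) = braided_int (negPsi X) 2 (tdeg2 th') ->
  bprod2 X th = bprod2 X th'.
Proof.
have nl := lin_negPsi XP => e.
apply/eqP; rewrite !bprod2E -subr_eq0 -(linB _ _ (@lin_bcls _ _ _ X)) -(linB _ _ lin_tdeg2).
apply/eqP/bcls_ker; exists 2; first exact: thomog_tdeg2.
rewrite braided_factE // -[bfact _ _ _ _]/(bfact _ 1 1 (bint _ 0 2 _)) -braided_intE //.
rewrite (linB _ _ lin_tdeg2) (linB (f := braided_int (negPsi X) 2)).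
  by rewrite e subrr (lin0 (lin_bfact nl _ _)) (lin0 (lin_tfilter _)).
by move=> c x y; rewrite !braided_intE //; apply: lin_bint.
Qed.

End DegreeTwo.

#[export] Hint Resolve lin_tdeg2 : lin.

(** * The restriction of a differential to left-invariant forms *)

Section Differential.
Variables (k : fieldType) (A : hopfType k) (V : lmodType k).
Variable X : crossed_ops A V.
Hypothesis XP : is_crossed X.
Implicit Types U : lmodType k.
Local Notation B := (bext X).
Local Notation smash := (smash X).

Section Calculus.
Variable w : A -> V.
Hypothesis wl : lin w.

(* [sdeg1 (d x)] for a differential [d] that extends the calculus given by [w]. *)
Definition sdiff0 (x : smash) : V := \swd_(a, e <- x) (bdeg0 e *: w a).

Lemma lin_sdiff0 : lin sdiff0. Proof. by rewrite /sdiff0; lin. Qed.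
Hint Resolve lin_sdiff0 : lin.

Lemma sdiff0_tens a e : sdiff0 (a ⊗ e) = bdeg0 e *: w a.
Proof. by rewrite /sdiff0 swd_tens //; lin. Qed.

(** This is the contribution of [d ⊗ id] in bidegree (1,1). A first factor of degree 0 in the
    coproduct of [1 ⊗ e] coacts trivially, so [w] is evaluated at 1. *)
Lemma scomul_diffl e :
  \swd_(x1, x2 <- scomul (1 ⊗ e : smash)) (sdiff0 x1 ⊗ sdeg1 x2) = w 1 ⊗ bdeg1 e.
Proof.
rewrite (swd_scomul _ (G := fun x1 x2 => sdiff0 x1 ⊗ sdeg1 x2)); last by lin.
transitivity (\swd_(a, e <- (1 ⊗ e : smash)) \swd_(a1, a2 <- comul a)
    (w a1 ⊗ (counit (a2 * 1) *: bdeg1 e))).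
  apply: eq_swd => {}a {}e; apply: eq_swd => a1 a2.
  rewrite -(bcomul_deg0l XP _ (f := fun e => w a1 ⊗ (counit (a2 * 1) *: bdeg1 e)));
    last by lin.
  apply: eq_swd => e1 e2.
  rewrite -(bcoact_deg0 XP _ (f := fun f1 => w a1 ⊗ (counit (a2 * f1) *: bdeg1 e2)));
    last by lin.
  apply: eq_swd => f0 f1; rewrite sdiff0_tens sdeg1_tens //.
  by rewrite (linZ (f := fun x => x ⊗ _)) //; lin.
rewrite swd_tens; last by lin.
by rewrite comul1 swd_tens ?mulr1 ?counit1 ?scale1r //; lin.
Qed.

(** This is the contribution of [id ⊗ d]. Now the factor of degree 0 is the second one, into which
    the bosonisation has multiplied the coaction of the first; this is where eta_0 ⊗ omega (pi
    eta_1) comes from. *)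
Lemma scomul_diffr e :
  \swd_(x1, x2 <- scomul (1 ⊗ e : smash)) (sdeg1 x1 ⊗ sdiff0 x2) =
  \swd_(v0, v1 <- rcoact X (bdeg1 e)) v0 ⊗ w v1.
Proof.
rewrite (swd_scomul _ (G := fun x1 x2 => sdeg1 x1 ⊗ sdiff0 x2)); last by lin.
transitivity (\swd_(a, e <- (1 ⊗ e : smash)) \swd_(a1, a2 <- comul a)
    \swd_(v0, v1 <- rcoact X (bdeg1 e)) ((counit a1 *: v0) ⊗ w (a2 * v1))).
  apply: eq_swd => {}a {}e; apply: eq_swd => a1 a2.
  rewrite -(bcomul_deg1l XP _ (f := fun v => \swd_(v0, v1 <- rcoact X v)
    ((counit a1 *: v0) ⊗ w (a2 * v1)))); last by lin.
  apply: eq_swd => e1 e2; rewrite -[RHS]swdZ.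
  rewrite -(bcoact_deg1 XP _ (F := fun v0 v1 =>
    bdeg0 e2 *: ((counit a1 *: v0) ⊗ w (a2 * v1)))); last by lin.
  apply: eq_swd => f0 f1; rewrite sdiff0_tens sdeg1_tens //.
  by rewrite (linZ (f := tens _)) //; lin.
rewrite swd_tens; last by lin.
rewrite comul1 swd_tens; last by lin.
by apply: eq_swd => v0 v1; rewrite counit1 scale1r mul1r.
Qed.

End Calculus.

Variable omega : Aplus A -> V.
Hypothesis omegal : lin omega.
Local Notation w := (fun a => omega (aug_proj a)).

Let wl : lin w. Proof. by lin. Qed.

Let w1 : omega (aug_proj (1 : A)) = 0. Proof. by rewrite aug_proj1 (lin0 omegal). Qed.

Variable d : smash -> smash.
Hypothesis dP : strongly_bicovariant d.
Hypothesis dE : extends_calculus omega d.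

Let dl : lin d. Proof. by case: dP. Qed.

Definition delta (e : B) : B := sinvariant (d (1 ⊗ e)).

Lemma lin_delta : lin delta.
Proof. by rewrite /delta; lin. Qed.

Lemma delta_homog n e : bhomog n e -> bhomog n.+1 (delta e).
Proof.
by case: dP => _ dh _ _ _ he; apply: sinvariant_homog => //; apply/dh/shomog_tens.
Qed.

Lemma d_word_homog a s : shomog (size s).+1 (d (a ⊗ bcls X (word s))).
Proof.
case: dP => _ dh _ _ _; apply/dh/shomog_tens; exists (word s) => //.
exact: thomog_word.
Qed.

Lemma sdeg0_d x : sdeg0 (d x) = 0.
Proof.
apply: (smash_ext (f := fun x => sdeg0 (d x)) (g := fun=> 0)) => [||a s].
- by lin.
- by lin.
- exact: (sdeg0_homog (d_word_homog a s)).
Qed.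

(** Since [d] raises the degree by one, only the degree 0 part of [x] contributes, and there [d] is
    the given calculus. *)
Lemma sdeg1_d x : sdeg1 (d x) = sdiff0 w x.
Proof.
apply: (smash_ext (f := fun x => sdeg1 (d x)) (g := sdiff0 w)) => [||a [|v s]].
- by lin.
- exact: lin_sdiff0.
- rewrite sdiff0_tens // bdeg0_bcls // deg0_word scale1r dE.
  rewrite (lin_swd _ _ (g := @sdeg1 _ _ _ X)); last by lin.
  rewrite -[RHS](swd_counitl (f := w)) //; apply: eq_swd => a1 a2.
  by rewrite sdeg1_tens // bdeg1_incl.
- rewrite (sdeg1_homog XP (d_word_homog a (v :: s))) sdiff0_tens // bdeg0_bcls // deg0_word.
  by rewrite scale0r.
Qed.

(* Projecting the first factor of the coderivation property to degree 0 shows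
   that [d] is left covariant, so that [d (1 ⊗ e)] is left invariant. *)
Lemma d_left_invariant e : d (1 ⊗ e) = 1 ⊗ delta e.
Proof.
pose L (x : smash) := \swd_(x1, x2 <- scomul x) (sdeg0 x1 ⊗ x2).
have LE x : L x = \swd_(a, e <- x) \swd_(a1, a2 <- comul a) (a1 ⊗ (a2 ⊗ e)).
  exact: scomul_deg0l.
(* By the counit axiom an element is recovered from its left coaction. *)
have K (x : smash) : \swd_(a, y <- L x) (a ⊗ sinvariant y) = x.
  rewrite LE -[RHS]swd_id swd_swd; last by lin.
  apply: eq_swd => a {}e; rewrite swd_swd; last by lin.
  rewrite -[RHS](swd_counitr (f := fun a => a ⊗ e)); last by lin.
  apply: eq_swd => a1 a2; rewrite swd_tens; last by lin.
  by rewrite sinvariant_tens // (linZ (f := tens _)) //; lin.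
rewrite -[LHS]K; have -> : L (d (1 ⊗ e)) = 1 ⊗ d (1 ⊗ e); last by rewrite swd_tens //; lin.
transitivity (\swd_(a, y <- L (1 ⊗ e)) (a ⊗ d y)).
  case: dP => _ _ _ _ dc; rewrite /L dc !(swd_swd (scomul (1 ⊗ e))); [|by lin..].
  apply: eq_swd => x1 x2; rewrite swd_tens; last by lin.
  rewrite swd_tensD; last by lin.
  by rewrite sdeg0_d sdeg0_sparity // (lin0 (f := fun a => a ⊗ _)) ?add0r //; lin.
rewrite LE swd_tens; last by lin.
by rewrite comul1 !swd_tens //; lin.
Qed.

(** Apply the Leibniz rule to [a ⊗ e], the product of [a ⊗ 1] and [1 ⊗ e]; the first factor is even,
    so no sign appears. *)
Lemma d_formula a e : d (a ⊗ e) =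
  \swd_(a1, a2 <- comul a) a1 ⊗ bmul (bincl X (w a2)) e + a ⊗ delta e.
Proof.
rewrite -[e in LHS](bmul1l XP) -smul_tens1 //.
case: dP => _ _ _ dd _; rewrite dd dE d_left_invariant; congr (_ + _).
  rewrite (lin_swd _ _ (g := fun x => smul x (1 ⊗ e))); last by lin.
  by apply: eq_swd => a1 a2; rewrite smul_tens1.
rewrite sparity_tens // bparity_word // scale1r smul_tens1 //.
by rewrite bmul1l.
Qed.

Lemma delta_bmul x y :
  delta (bmul x y) = bmul (delta x) y + bmul (bparity x) (delta y).
Proof.
rewrite {1}/delta -smul_tens1 //; case: dP => _ _ _ dd _.
rewrite dd !d_left_invariant sparity_tens // !smul_tens1 //.
by rewrite (linD (@lin_sinvariant _ _ _ X)) !sinvariant_tens // counit1 !scale1r.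
Qed.

Lemma delta_one : delta (bone X) = 0.
Proof.
rewrite /delta dE comul1 swd_tens; last by lin.
by rewrite sinvariant_tens // w1 (lin0 (lin_bincl X)) scaler0.
Qed.

Lemma delta_incl v :
  exists2 th, is_preimage X omega v th & delta (bincl X v) = - bprod2 X th.
Proof.
have [t ht dt] : bhomog 2 (delta (bincl X v)).
  by apply: delta_homog; exists (word [:: v]) => //; exact: (thomog_word [:: v]).
(* The preimage is read off from the differential itself: [t] represents [delta] of the generator in
   degree 2. *)
exists (- deg2 t); last first.
  by rewrite bprod2E // (linN _ (@lin_tdeg2 _ _)) -thomog2E // (linN _ (@lin_bcls _ _ _ X)) opprK.
rewrite /is_preimage braided_int2 //; congr tdeg2.
rewrite (linN _ (lin_Psi XP)) -opprD.
have <- : bdeg11 (delta (bincl X v)) = deg2 t - Psi X (deg2 t) by rewrite dt bdeg11_bcls.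
rewrite -scomul_deg11 // -d_left_invariant; case: dP => _ _ _ _ dc.
rewrite dc swd_swd; last by lin.
(* The inner minus comes from the parity on a factor of degree 1, the outer one from the sign of the
   witness; since [w] vanishes at 1, only the second term survives and the two signs cancel. *)
transitivity (- (\swd_(x1, x2 <- scomul (1 ⊗ bincl X v : smash))
  (sdiff0 w x1 ⊗ sdeg1 x2 - sdeg1 x1 ⊗ sdiff0 w x2))).
  congr (- _); apply: eq_swd => x1 x2.
  rewrite swd_tensD; last by lin.
  by rewrite sdeg1_sparity // !sdeg1_d (linN (f := fun v => v ⊗ _)) //; lin.
rewrite swdD swdN scomul_diffl // scomul_diffr // w1 bdeg1_incl //.
by rewrite (lin0 (f := fun v => v ⊗ _)) ?sub0r ?opprK //; lin.
Qed.

End Differential.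

(** * Uniqueness of the differential *)

Section Uniqueness.
Variables (k : fieldType) (A : hopfType k) (V : lmodType k).
Variable X : crossed_ops A V.
Hypothesis XP : is_crossed X.
Variable omega : Aplus A -> V.
Hypothesis omegal : lin omega.

Lemma delta_preimage (d : smash X -> smash X) v th :
  strongly_bicovariant d -> extends_calculus omega d -> is_preimage X omega v th ->
  delta d (bincl X v) = - bprod2 X th.
Proof.
move=> dP dE pth; have [th' pth' ->] := delta_incl XP omegal dP dE v.
by congr (- _); apply: bprod2_braided_int => //; rewrite pth.
Qed.

Lemma differential_unique (d d' : smash X -> smash X) :
  strongly_bicovariant d -> extends_calculus omega d ->
  strongly_bicovariant d' -> extends_calculus omega d' -> d' =1 d.
Proof.
move=> dP dE dP' dE'.
have [[dl _ _ _ _] [dl' _ _ _ _]] := (dP, dP').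
have dE1 : delta d' =1 delta d.
  apply: bext_ext => [||s]; [exact: lin_delta|exact: lin_delta|].
  elim: s => [|v s IHs]; first by rewrite (delta_one _ dE') ?(delta_one _ dE).
  rewrite -bmul_incl // (delta_bmul XP dP') (delta_bmul XP dP) IHs; congr (bmul _ _ + _).
  (* Being a preimage depends on [omega] and [v] only, so the one obtained from [d'] also computes
     [delta d]. *)
  have [th pth ->] := delta_incl XP omegal dP' dE' v.
  by rewrite (delta_preimage dP dE pth).
apply: tensor_ext => // a e.
by rewrite (d_formula XP dP' dE') (d_formula XP dP dE) dE1.
Qed.

End Uniqueness.

Theorem corollary4p11 (k : fieldType) (char_not2 : 2%N \notin [pchar k])
  (A H : hopfType k) (pair : A -> H -> k)
  (pairP : hopf_pairing pair) (pair_nondeg : nondegenerate_pairing pair)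
  (SA_bij : bijective (antipode : A -> A)) (SH_bij : bijective (antipode : H -> H))
  (L1 : vectType k)
  (X : crossed_ops A L1) (XP : is_crossed X)
  (Y : crossed_ops H 'Hom(L1, k^o)) (YP : is_crossed Y)
  (XY_adj : mutually_adjoint pair X Y)
  (omega : Aplus A -> L1) (omegaP : crossed_map (aplus_ops A) X omega) :
  (forall th th' : L1 ⊠ L1,
     braided_int (negPsi X) 2 (tdeg2 th) = braided_int (negPsi X) 2 (tdeg2 th') ->
     bprod2 X th = bprod2 X th') /\
  ((exists d : smash X -> smash X,
      strongly_bicovariant d /\ extends_calculus omega d) ->
   exists d : smash X -> smash X,
     [/\ strongly_bicovariant d /\ extends_calculus omega d,
         forall d' : smash X -> smash X,
           strongly_bicovariant d' -> extends_calculus omega d' -> d' =1 d &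
         exists delta : bext X -> bext X,
           [/\ bsuper_derivation1 delta,
               forall a eta, d (a ⊗ eta) =
                 \swd_(a1, a2 <- comul a)
                   a1 ⊗ bmul (bincl X (omega (aug_proj a2))) eta
                 + a ⊗ delta eta &
               forall eta : L1,
                 (exists th, is_preimage X omega eta th) /\
                 (forall th, is_preimage X omega eta th ->
                    delta (bincl X eta) = - bprod2 X th)]]).
Proof.
have [omegal _ _] := omegaP.
split=> [th th'|[d [dP dE]]]; first exact: bprod2_braided_int.
exists d; split=> // [d' dP' dE'|]; first exact: (differential_unique XP omegal).
exists (delta d); split.
- split; [exact: lin_delta|exact: delta_homog|].
  exact: delta_bmul.
- exact: d_formula.
move=> eta; split=> [|th]; last exact: delta_preimage.
by have [th pth _] := delta_incl XP omegal dP dE eta; exists th.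
Qed.
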